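(* Consider the initial value problem for the Degasperis-Procesi equation $$\partial_t u-\partial_x^2\partial_t u+4u\partial_x u=3\partial_x u\,\partial_x^2 u+u\,\partial_x^3 u,\quad x,t\in\mathbb{R},\qquad u(x,0)=u_0(x).$$ Suppose $u_0\in H^{1+\delta}(\mathbb{R})\cap W^{1,\infty}(\mathbb{R})$ for some $\delta>0$, and that for some open subset $\Omega\subseteq\mathbb{R}$ $$u_0\big|_{\Omega}\in C^1.$$ Then the local solution $u=u(x,t)$, $t\in[0,T]$, of the initial value problem (described in the context) satisfies, for $t\in[0,T]$, $$u(\cdot,t)\in C^1(\Omega_t),$$ where $\Omega_t=\Phi_t(\Omega)$ and $\Phi_t(x_0)=X(t;x_0)$ is the map given by $$\frac{dX}{dt}=u(X(t),t),\qquad X(0)=x_0.$$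
   Context: The equation is understood in the equivalent integro-differential form $$\partial_t u+u\partial_x u+\tfrac32(1-\partial_x^2)^{-1}\partial_x(u^2)=0,\qquad (1-\partial_x^2)^{-1}f=\tfrac12 e^{-|x|}*f,$$ realized in $C([0,T]:L^2(\mathbb{R}))$. The solution: for $u_0\in H^{1+\delta}(\mathbb{R})\cap W^{1,\infty}(\mathbb{R})$, $\delta>0$, there exist $T>0$, depending on $\|u_0\|_{H^{1+\delta}}$ and $\|u_0\|_{W^{1,\infty}}$, and a unique strong solution (limit of classical solutions) $u\in C([0,T]:H^1(\mathbb{R}))\cap L^\infty([0,T]:H^{1+\delta}(\mathbb{R}))\cap L^\infty([0,T]:W^{1,\infty}(\mathbb{R}))$. For such $u$ the flow $\Phi_t$ is well defined on $[0,T]$. *)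

(* Defs.v *)
From mathcomp Require Import all_boot all_order all_algebra.
From mathcomp Require Import all_classical all_reals all_analysis.

Set Implicit Arguments.
Unset Strict Implicit.
Unset Printing Implicit Defensive.

Import Order.TTheory GRing.Theory Num.Theory.
Import numFieldNormedType.Exports.

Local Open Scope classical_set_scope.
Local Open Scope ring_scope.

(* Elements of the function spaces on the line are represented by functions
   R -> R, and functions of time and space by R -> R -> R with the time
   variable first, so that [u t] is the spatial profile at time [t]. *)

Section function_spaces.
Context {R : realType}.
Local Notation mu := (@lebesgue_measure R).
Implicit Types (f g a b phi : R -> R) (s t T : R) (I A : set R).

Definition L2 f : Prop := f \in Lfun mu 2%:E.

Definition norm2 f : \bar R := 'N[mu]_2%:E[EFin \o f].

Definition normoo f : \bar R := 'N[mu]_+oo[EFin \o f].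

(* Real and imaginary parts of
   (2 pi)^(-1/2) \int_(-n)^n f(y) exp(- i y xi) dy. *)
Definition fourier_re f (n : nat) (xi : R) : R :=
  (Num.sqrt (2 * pi))^-1 *
  \int[mu]_(y in `[- n%:R, n%:R]) (f y * cos (y * xi)).

Definition fourier_im f (n : nat) (xi : R) : R :=
  - ((Num.sqrt (2 * pi))^-1 *
     \int[mu]_(y in `[- n%:R, n%:R]) (f y * sin (y * xi))).

(* [a + i b] represents the Fourier-Plancherel transform of [f]: the L^2 limit
   of the Fourier transforms of the truncations of [f] to [-n, n]. *)
Definition is_fourier f a b : Prop :=
  [/\ L2 f, L2 a, L2 b,
      norm2 (fourier_re f n \- a) @[n --> \oo] --> 0%E &
      norm2 (fourier_im f n \- b) @[n --> \oo] --> 0%E].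

(* || (1 + xi^2)^(s/2) \hat f ||_(L^2).  Two transforms of [f] agree almost
   everywhere, so the infimum is over at most one value; it is +oo when [f]
   is not in L^2. *)
Definition norm_Hs s f : \bar R :=
  ereal_inf [set N | exists a b, is_fourier f a b /\
    N = norm2 (fun xi => (1 + xi ^+ 2) `^ (s / 2) *
                         Num.sqrt (a xi ^+ 2 + b xi ^+ 2))].

Definition Hs s f : Prop := (norm_Hs s f < +oo)%E.

(* C^1 test functions with compact support; since f and g below are locally
   integrable, smooth ones would give the same notion (by mollification). *)
Definition test_function phi : Prop :=
  [/\ forall x, derivable phi x 1,
      continuous (derive1 phi) &
      exists M, forall x, M < `|x| -> phi x = 0].

Definition weak_derivative f g : Prop :=
  [/\ locally_integrable setT f, locally_integrable setT g &
      forall phi, test_function phi ->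
        \int[mu]_x (f x * derive1 phi x) = - \int[mu]_x (g x * phi x)].

Definition norm_W1oo f : \bar R :=
  ereal_inf [set N | exists g, weak_derivative f g /\
    N = (normoo f + normoo g)%E].

Definition W1oo f : Prop := (norm_W1oo f < +oo)%E.

(* C^1 regularity on an open set A of a function defined on the line *)
Definition C1_on A f : Prop :=
  (forall x, A x -> derivable f x 1) /\ {within A, continuous (derive1 f)}.

(* f is in C(I : X), where X is the space of all h with norm h < +oo *)
Definition continuous_in (norm : (R -> R) -> \bar R) I (w : R -> R -> R) : Prop :=
  forall t, I t -> norm (w s \- w t) @[s --> within I (nbhs t)] --> 0%E.

Definition C_L2 I (w : R -> R -> R) : Prop :=
  (forall t, I t -> L2 (w t)) /\ continuous_in norm2 I w.

Definition C_H1 I (w : R -> R -> R) : Prop :=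
  (forall t, I t -> Hs 1 (w t)) /\ continuous_in (norm_Hs 1) I w.

(* Essential boundedness in time; L^oo(I : W^{1,oo}) is meant in this sense
   (no strong measurability with values in a nonseparable space). *)
Definition ess_bounded_in (norm : (R -> R) -> \bar R) I (w : R -> R -> R) : Prop :=
  exists M : R, {ae mu, forall t, I t -> (norm (w t) <= M%:E)%E}.

(* Derivative in time, relative to I, of w as an L^2-valued function *)
Definition L2_time_derivative I (w dw : R -> R -> R) : Prop :=
  forall t, I t ->
    norm2 (fun x => (w s x - w t x) / (s - t) - dw t x)
      @[s --> within I t^'] --> 0%E.

(* (1 - d_x^2)^(-1) f = (1/2) exp(- |x|) * f *)
Definition helmholtz_inv f : R -> R :=
  fun x => 2^-1 * \int[mu]_y (expR (- `|x - y|) * f y).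

End function_spaces.

Section Degasperis_Procesi.
Context {R : realType}.
Local Notation mu := (@lebesgue_measure R).
Implicit Types (delta T : R) (u v Phi : R -> R -> R).

Definition d_t v : R -> R -> R := fun t x => derive1 (v ^~ x) t.

Definition d_x v : R -> R -> R := fun t x => derive1 (v t) x.

Definition continuous2_at v (t x : R) : Prop :=
  {for (t, x), continuous (fun p : R * R => v p.1 p.2)}.

(* Every derivative occurring in the equation exists and is jointly continuous
   for 0 < t < T, and v itself is continuous up to t = 0 and t = T. *)
Definition DP_classical T v : Prop :=
  {within (`[0, T] `*` setT), continuous (fun p : R * R => v p.1 p.2)} /\
  forall t x, t \in `]0, T[ ->
  [/\ [/\ derivable (v ^~ x) t 1,
          derivable (v t) x 1,
          derivable (d_x v t) x 1 &
          derivable (d_x (d_x v) t) x 1],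
      derivable (d_t v t) x 1 /\ derivable (d_x (d_t v) t) x 1,
      [/\ continuous2_at (d_x v) t x,
          continuous2_at (d_x (d_x v)) t x &
          continuous2_at (d_x (d_x (d_x v))) t x],
      [/\ continuous2_at (d_t v) t x,
          continuous2_at (d_x (d_t v)) t x &
          continuous2_at (d_x (d_x (d_t v))) t x] &
      d_t v t x - d_x (d_x (d_t v)) t x + 4 * v t x * d_x v t x
      = 3 * d_x v t x * d_x (d_x v) t x + v t x * d_x (d_x (d_x v)) t x].

(* Integro-differential form
     u_t + u u_x + (3/2) (1 - d_x^2)^(-1) d_x (u^2) = 0   in C([0, T] : L^2);
   ux and q are the weak space derivatives of u and of u^2. *)
Definition DP_integro T u : Prop :=
  exists ut ux q : R -> R -> R,
  [/\ forall t, t \in `[0, T] ->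
        weak_derivative (u t) (ux t) /\
        weak_derivative (fun x => u t x ^+ 2) (q t),
      L2_time_derivative `[0, T] u ut,
      [/\ C_L2 `[0, T] ut,
          C_L2 `[0, T] (fun t x => u t x * ux t x) &
          C_L2 `[0, T] (fun t => helmholtz_inv (q t))] &
      forall t, t \in `[0, T] ->
        {ae mu, forall x,
          ut t x + u t x * ux t x + 3 / 2 * helmholtz_inv (q t) x = 0}].

(* Each profile is taken to be its continuous representative, so that
   pointwise values of the solution are meaningful. *)
Definition DP_strong_solution delta T (u0 : R -> R) u : Prop :=
  [/\ (forall t, t \in `[0, T] -> continuous (u t)) /\ u 0 = u0,
      [/\ C_H1 `[0, T] u,
          ess_bounded_in (norm_Hs (1 + delta)) `[0, T] u &
          ess_bounded_in norm_W1oo `[0, T] u],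
      DP_integro T u &
      exists v : nat -> R -> R -> R,
        (forall n, DP_classical T (v n)) /\
        ereal_sup [set norm_Hs 1 (v n t \- u t) | t in `[0, T]]
          @[n --> \oo] --> 0%E].

(* The time derivative is one-sided at the endpoints of [0, T]. *)
Definition is_flow T u Phi : Prop :=
  forall x0, Phi 0 x0 = x0 /\
    forall t, t \in `[0, T] ->
      (Phi s x0 - Phi t x0) / (s - t)
        @[s --> within `[0, T] t^'] --> u t (Phi t x0).

End Degasperis_Procesi.

(* Main.v *)
Require Import Defs.
From mathcomp Require Import all_boot all_order all_algebra.
From mathcomp Require Import all_classical all_reals all_analysis.
From mathcomp Require Import measurable_realfun ess_sup_inf ring lra.
Import Order.TTheory GRing.Theory Num.Theory.
Import numFieldNormedType.Exports.
Local Open Scope classical_set_scope.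
Local Open Scope ring_scope.

(** The equation reads u_t + u u_x + (3/2) h = 0, where h = (1 - d_x^2)^(-1) q
    and q is the space derivative of u^2.  The solution is bounded and
    Lipschitz in space, so q is bounded and h, being one derivative smoother
    than u, is continuously differentiable in space, with a modulus for its
    difference quotients that does not depend on time
    ([helmholtz_inv_slope]).  Along a characteristic X' = u(t, X) the velocity
    obeys d/dt u(t, X) = - (3/2) h(t, X) ([velocity_derive]).  Hence the
    difference quotient
      rho = (u(t, X1) - u(t, X2)) / (X1 - X2)
    along two characteristics solves the Riccati equation
      rho' = - rho^2 - (3/2) (h(t, X1) - h(t, X2)) / (X1 - X2)
    ([slope_riccati]), and |rho| stays below the Lipschitz constant of u.

    Take two pairs of characteristics issued from near a point y0 of Omega.
    Their quotients solve this equation with nearly the same source, so by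
    Gronwall their distance at time t is controlled by their distance at time
    0 ([rate_gronwall]), and the latter is small because u0 is C^1 near y0.  So
    the difference quotients of u(t, .) over pairs of points tending to
    Phi_t(y0) form a Cauchy family ([strict_slopes_transport]): u(t, .) is
    strictly differentiable at every point of Phi_t(Omega), which forces it
    to be C^1 there ([strict_slopes_C1_on]).  This works with the quotients
    themselves; the flow is never differentiated in its initial point, one
    only needs that Phi_t is increasing and Lipschitz ([flow_increasing],
    [flow_lipschitz]).

    The rest of the work makes the hypotheses usable pointwise.  A continuous
    function is the primitive of its weak derivative ([weak_derivative_FTC]),
    which is therefore its derivative almost everywhere.  The derivative of u
    in time, only given in L^2, is exploited through the integrals of u over
    intervals: these are differentiable in time with an explicit flux, they
    propagate the essential bounds to every time ([u_bounds]) and show that u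
    is Lipschitz in time ([u_time_lipschitz]).  Finally the average of u over a
    short interval that moves with a characteristic has a derivative close to
    - (3/2) h, because the fluxes through the two ends cancel the transport
    term up to second order in the length. *)

Set Implicit Arguments.
Unset Strict Implicit.

(** * Derivatives, null sets and local integrability *)

Section WeakDerivative.
Context {R : realType}.
Local Notation mu := (@lebesgue_measure R).
Implicit Types (f g : R -> R) (a b c d x y : R).

Lemma is_derive_approx f x d :
  (forall e, 0 < e ->
    \forall y \near x, `|f y - f x - d * (y - x)| <= e * `|y - x|) ->
  is_derive x 1 f d.
Proof.
move=> H; apply/is_derive1_caratheodory.
exists (fun z => if z == x then d else (f z - f x) / (z - x)); split.
- move=> z; case: eqP => [->|/eqP zx]; first by rewrite !subrr mulr0.
  by rewrite divfK// subr_eq0.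
- apply/cvgrPdist_le => e e0.
  rewrite eqxx; near=> z => /=.
  have [_|zx] := eqVneq z x; first by rewrite subrr normr0 ltW.
  have zx0 : z - x != 0 by rewrite subr_eq0.
  rewrite -(@ler_pM2r _ `|z - x|) ?normr_gt0// -normrM mulrBl divfK//.
  rewrite distrC; near: z; exact: H.
- by rewrite eqxx.
Unshelve. all: by end_near. Qed.

Lemma is_derive_approxE f x d : is_derive x 1 f d ->
  forall e, 0 < e ->
    \forall y \near x, `|f y - f x - d * (y - x)| <= e * `|y - x|.
Proof.
move/is_derive1_caratheodory => [h [fE hC hx]] e e0.
have /cvgrPdist_le/(_ _ e0) := hC; rewrite hx => nh.
near=> y; rewrite fE -mulrBl normrM ler_wpM2r//.
by rewrite distrC; near: y.
Unshelve. all: by end_near. Qed.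

(** Differentiates piecewise polynomial formulas at their nodes without
    one-sided limits. *)
Lemma is_derive_quadratic f x d C :
  (forall y, `|f y - f x - d * (y - x)| <= C * (y - x) ^+ 2) ->
  is_derive x 1 f d.
Proof.
move=> H; apply: is_derive_approx => e e0.
have K0 : 0 < `|C| + 1 by rewrite ltr_pwDr.
near=> y; apply: le_trans (H y) _.
rewrite -(real_normK (num_real (y - x))) expr2 mulrA ler_wpM2r//.
apply: (@le_trans _ _ ((`|C| + 1) * `|y - x|)).
  by rewrite ler_wpM2r// (le_trans (ler_norm C))// lerDl.
rewrite mulrC -ler_pdivlMr// distrC; near: y.
apply: filterS (nbhsx_ballx x (e / (`|C| + 1)) (divr_gt0 e0 K0)) => y.
by rewrite -ball_normE /= => /ltW.
Unshelve. all: by end_near. Qed.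

(** Null sets contain no interval: this is how a property that holds almost
    everywhere is brought to bear on continuous functions. *)
Lemma ae_in_itv (P : R -> Prop) a b : a < b -> {ae mu, forall x, P x} ->
  exists2 x, a < x < b & P x.
Proof.
move=> ab [N [mN N0 sub]].
apply: contrapT => H.
have sI : `]a, b[%classic `<=` N.
  move=> x /=; rewrite in_itv/= => xab; apply: sub => /= Px.
  by apply: H; exists x.
have : (mu `]a, b[%classic <= mu N)%E.
  by apply: le_measure => //; rewrite inE//; exact: measurable_itv.
rewrite N0 lebesgue_measure_itv/= lte_fin ab -EFinB lee_fin subr_le0.
by rewrite leNgt ab.
Qed.

Lemma integrable_itv f a b : locally_integrable setT f ->
  mu.-integrable `[a, b] (EFin \o f).
Proof.
move=> [mf _ lf]; apply/integrableP; split.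
  apply/measurable_EFinP; exact: measurable_funS mf.
by apply: lf => //; exact: segment_compact.
Qed.

Lemma continuous_integrable f a b : continuous f ->
  mu.-integrable `[a, b] (EFin \o f).
Proof.
move=> cf; apply: continuous_compact_integrable; first exact: segment_compact.
exact: continuous_subspaceT.
Qed.

End WeakDerivative.

(** * Spline test functions *)

Section Ramp.
Context {R : realType}.
Local Notation mu := (@lebesgue_measure R).
Implicit Types (f g : R -> R) (a b c d x y k p : R).

(** The hat function on [0, 2] with peak 1 at 1, and its primitive [ramp],
    which rises from 0 to 1; positive parts give one formula for all pieces. *)
Definition tent x : R :=
  Num.max 0 x - 2 * Num.max 0 (x - 1) + Num.max 0 (x - 2).

Definition ramp x : R :=
  (Num.max 0 x ^+ 2 - 2 * Num.max 0 (x - 1) ^+ 2 + Num.max 0 (x - 2) ^+ 2) / 2.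

Lemma tent_bounds x : 0 <= tent x <= 1.
Proof.
rewrite /tent; have [?|?] := leP 0 x; have [?|?] := leP 0 (x - 1);
  have [?|?] := leP 0 (x - 2); lra.
Qed.

Lemma tent_out x : x <= 0 \/ 2 <= x -> tent x = 0.
Proof.
rewrite /tent; have [?|?] := leP 0 x; have [?|?] := leP 0 (x - 1);
  have [?|?] := leP 0 (x - 2); lra.
Qed.

Lemma ramp_bounds x : 0 <= ramp x <= 1.
Proof.
rewrite /ramp; have [?|?] := leP 0 x; have [?|?] := leP 0 (x - 1);
  have [?|?] := leP 0 (x - 2); apply/andP; split; nra.
Qed.

Lemma ramp0 x : x <= 0 -> ramp x = 0.
Proof.
rewrite /ramp; have [?|?] := leP 0 x; have [?|?] := leP 0 (x - 1);
  have [?|?] := leP 0 (x - 2); nra.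
Qed.

Lemma ramp1 x : 2 <= x -> ramp x = 1.
Proof.
rewrite /ramp; have [?|?] := leP 0 x; have [?|?] := leP 0 (x - 1);
  have [?|?] := leP 0 (x - 2); nra.
Qed.

Lemma pos_part_sqr x y :
  `|Num.max 0 y ^+ 2 - Num.max 0 x ^+ 2 - 2 * Num.max 0 x * (y - x)|
    <= (y - x) ^+ 2.
Proof.
have := sqr_ge0 x; have := sqr_ge0 y; have := sqr_ge0 (y - x).
rewrite ler_norml !expr2.
have [x0|x0] := leP 0 x; have [y0|y0] := leP 0 y => ? ? ?;
  apply/andP; split; rewrite ?mul0r ?mulr0 ?subr0 ?mul0r ?sub0r.
all: try nra.
Qed.

Lemma ramp_derive k a x :
  is_derive x 1 (fun z => ramp (k * (z - a))) (k * tent (k * (x - a))).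
Proof.
apply: (@is_derive_quadratic _ _ _ _ (2 * k ^+ 2)) => y.
have := pos_part_sqr (k * (x - a)) (k * (y - a)).
have := pos_part_sqr (k * (x - a) - 1) (k * (y - a) - 1).
have := pos_part_sqr (k * (x - a) - 2) (k * (y - a) - 2).
have E z : k * (y - a) - z - (k * (x - a) - z) = k * (y - x) by ring.
rewrite !E.
have -> : k * (y - a) - k * (x - a) = k * (y - x) by ring.
rewrite exprMn !ler_norml /ramp /tent => /andP[? ?] /andP[? ?] /andP[? ?].
apply/andP; split; lra.
Qed.

Lemma tent_continuous k a : continuous (fun z => k * tent (k * (z - a))).
Proof.
move=> x; apply: cvgM; first exact: cvg_cst.
have cm (w : R -> R) : {for x, continuous w} ->
    (fun z => Num.max 0 (w z)) @ x --> Num.max 0 (w x).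
  move=> cw; rewrite (_ : (fun z => Num.max 0 (w z)) = (fun=> 0) \max w)//.
  by apply: continuous_max => //; exact: cvg_cst.
have ck : {for x, continuous (fun z => k * (z - a))}.
  by apply: cvgM; [exact: cvg_cst|apply: cvgB => //; exact: cvg_cst].
apply: cvgD; [apply: cvgB; [exact: cm|]|].
- apply: cvgM; first exact: cvg_cst.
  by apply: (cm (fun z => k * (z - a) - 1)); apply: cvgB => //; exact: cvg_cst.
- by apply: (cm (fun z => k * (z - a) - 2)); apply: cvgB => //; exact: cvg_cst.
Qed.

(** The integral is the increment of the primitive [ramp], from 0 to 1. *)
Lemma tent_mass k p c d : 0 < k -> c <= p -> p + 2 / k <= d ->
  \int[mu]_(x in `[c, d]) (k * tent (k * (x - p))) = 1.
Proof.
move=> k0 cp pd.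
have cd : c < d.
  by apply: lt_le_trans pd; rewrite (le_lt_trans cp)// ltrDl divr_gt0.
have dr x := ramp_derive k p x.
have cr : continuous (fun z => ramp (k * (z - p))).
  move=> x; apply: differentiable_continuous; apply/derivable1_diffP.
  exact: (@ex_derive _ _ _ _ _ _ _ (dr x)).
rewrite /Rintegral (@continuous_FTC2 _ _ (fun z => ramp (k * (z - p))))//.
- rewrite -EFinB /= ramp1 ?ramp0 ?subr0//.
    by rewrite pmulr_rle0// subr_le0.
  by rewrite mulrC -ler_pdivrMr// lerBrDl.
- exact/continuous_subspaceT/tent_continuous.
- split.
  + by move=> x _; exact: (@ex_derive _ _ _ _ _ _ _ (dr x)).
  + exact: cvg_at_right_filter (cr c).
  + exact: cvg_at_left_filter (cr d).
- by move=> x _; rewrite derive1E (@derive_val _ _ _ _ _ _ _ (dr x)).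
Qed.

(** The rescaled hats have mass one and support in [p, p + 2 / n.+1], so they
    are an approximate identity at the left end point p of the support. *)
Lemma tent_approx_id f p c d e : continuous f -> c <= p -> p < d -> 0 < e ->
  \forall n \near \oo,
    `|\int[mu]_(x in `[c, d]) (f x * (n.+1%:R * tent (n.+1%:R * (x - p)))) - f p|
      <= e.
Proof.
move=> cf cp pd e0.
have /cvgrPdist_le/(_ _ e0)[r /= r0 fr] := cf p.
have dl0 : 0 < Num.min r (d - p) by rewrite lt_min r0 subr_gt0.
near=> n.
set k : R := n.+1%:R.
have k0 : 0 < k by rewrite ltr0n.
have kd : 2 / k < Num.min r (d - p).
  rewrite ltr_pdivrMr// mulrC -ltr_pdivrMr//.
  apply: (@lt_trans _ _ n%:R); last by rewrite ltr_nat.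
  near: n; exact: nbhs_infty_gtr.
move: kd; rewrite lt_min => /andP[kr kdp].
have m1 : \int[mu]_(x in `[c, d]) (k * tent (k * (x - p))) = 1.
  by apply: tent_mass => //; rewrite -lerBrDl ltW.
have cps : continuous (fun x => k * tent (k * (x - p))) := @tent_continuous k p.
have ips := continuous_integrable c d cps.
have ifp : mu.-integrable `[c, d]
    (EFin \o (fun x => f x * (k * tent (k * (x - p))))).
  by apply: continuous_integrable => x; apply: cvgM; [exact: cf|exact: cps].
rewrite -[f p]mulr1 -m1 -RintegralZl// -RintegralB//; last first.
  by apply: continuous_integrable => x; apply: cvgM; [exact: cvg_cst|exact: cps].
apply: (le_trans (le_normr_Rintegral _ _)) => //.
  apply: continuous_integrable => x.
  by apply: cvgB; apply: cvgM; [exact: cf|exact: cps|exact: cvg_cst|exact: cps].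
rewrite -[leRHS]mulr1 -m1 -RintegralZl//.
apply: le_Rintegral => //.
- apply: continuous_integrable => x; apply: cvg_norm.
  by apply: cvgB; apply: cvgM; [exact: cf|exact: cps|exact: cvg_cst|exact: cps].
- by apply: continuous_integrable => x; apply: cvgM; [exact: cvg_cst|exact: cps].
move=> x _; rewrite -mulrBl normrM.
have [t0 _] := andP (tent_bounds (k * (x - p))).
have kt : 0 <= k * tent (k * (x - p)) by rewrite mulr_ge0// ltW.
rewrite [`|k * _|]ger0_norm//.
have [xp|xp] := leP x p.
  have -> : tent (k * (x - p)) = 0.
    by apply: tent_out; left; rewrite pmulr_rle0// subr_le0.
  by rewrite !mulr0.
have [px|px] := leP (p + 2 / k) x.
  have -> : tent (k * (x - p)) = 0.
    by apply: tent_out; right; rewrite mulrC -ler_pdivrMr// lerBrDl.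
  by rewrite !mulr0.
apply: ler_wpM2r => //.
rewrite distrC; apply: fr => /=.
rewrite distrC ger0_norm ?subr_ge0 ?ltW//.
by rewrite ltrBlDl (lt_trans px)// ltrD2l.
Unshelve. all: by end_near. Qed.

End Ramp.

(** * Weak derivatives of continuous functions *)

Section WeakFTC.
Context {R : realType}.
Local Notation mu := (@lebesgue_measure R).
Implicit Types (f g : R -> R) (a b c d x y k p : R).

(** For large k, a C^1 approximation of the indicator function of ]a, b]. *)
Definition plateau k a b x : R := ramp (k * (x - a)) - ramp (k * (x - b)).

Lemma plateau_derive k a b x :
  is_derive x 1 (plateau k a b)
    (k * tent (k * (x - a)) - k * tent (k * (x - b))).
Proof. by apply: is_deriveB; exact: ramp_derive. Qed.

Lemma plateau_derive1 k a b :
  derive1 (plateau k a b) =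
  fun x => k * tent (k * (x - a)) - k * tent (k * (x - b)).
Proof.
apply/funext => x; rewrite derive1E.
by rewrite (@derive_val _ _ _ _ _ _ _ (plateau_derive k a b x)).
Qed.

Lemma plateau_continuous k a b : continuous (plateau k a b).
Proof.
move=> x; apply: differentiable_continuous; apply/derivable1_diffP.
exact: (@ex_derive _ _ _ _ _ _ _ (plateau_derive k a b x)).
Qed.

Lemma plateau_out n a b x : a < b -> x <= a \/ b + 2 <= x ->
  plateau n.+1%:R a b x = 0.
Proof.
move=> ab; have n1 : 1 <= n.+1%:R :> R by rewrite ler1n.
rewrite /plateau => -[xa|xb].
  by rewrite !ramp0 ?subrr//; nra.
by rewrite !ramp1 ?subrr//; nra.
Qed.

Lemma plateau_test n a b : a < b -> test_function (plateau n.+1%:R a b).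
Proof.
move=> ab; split.
- move=> x; exact: (@ex_derive _ _ _ _ _ _ _ (plateau_derive _ a b x)).
- rewrite plateau_derive1 => x.
  by apply: cvgB; exact: tent_continuous.
- exists (`|a| + `|b| + 2) => x xM; apply: plateau_out => //.
  have [x0|x0] := ltP x 0.
    left; move: xM; rewrite (ltr0_norm x0) => xM.
    have := normr_ge0 b; have := ler_norm (- a); rewrite normrN; lra.
  right; move: xM; rewrite (ger0_norm x0) => xM.
  have := normr_ge0 a; have := ler_norm b; lra.
Qed.

Lemma plateau_norm k a b x : `|plateau k a b x| <= 1.
Proof.
have := ramp_bounds (k * (x - a)); have := ramp_bounds (k * (x - b)).
rewrite /plateau ler_norml; lra.
Qed.

Lemma plateau_cvg a b x : a < b ->
  plateau n.+1%:R a b x @[n --> \oo] --> (\1_(`]a, b]%classic) x : R).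
Proof.
move=> ab.
have big y : 0 < y -> \forall n \near \oo, 2 <= n.+1%:R * y.
  move=> y0; near=> n; rewrite -ler_pdivrMr//.
  apply: (@le_trans _ _ n%:R); last by rewrite ler_nat.
  near: n; exact: nbhs_infty_ger.
have n0 n : 0 < n.+1%:R :> R by rewrite ltr0n.
apply: cvg_near_cst.
have [xa|ax] := leP x a.
  near=> n; rewrite /plateau !ramp0; first last.
  - by have := n0 n; nra.
  - by have := n0 n; nra.
  by rewrite indicE memNset ?subrr//= in_itv/= ltNge xa.
have [xb|bx] := leP x b.
  near=> n; rewrite /plateau ramp1 ?ramp0; first last.
  - near: n; apply: big; lra.
  - by rewrite pmulr_rle0// subr_le0.
  by rewrite indicE mem_set ?subr0//= in_itv/= ax xb.
near=> n; rewrite /plateau !ramp1; first last.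
- near: n; apply: big; lra.
- near: n; apply: big; lra.
by rewrite indicE memNset ?subrr//= in_itv/= ax/= leNgt bx.
Unshelve. all: by end_near. Qed.

Lemma Rintegral_support f c d : (forall x, ~~ (c <= x <= d) -> f x = 0) ->
  \int[mu]_x f x = \int[mu]_(x in `[c, d]) f x.
Proof.
move=> f0; rewrite [RHS]Rintegral_mkcond; apply: eq_Rintegral => x _.
rewrite patchE; case: ifPn => // xcd; apply: f0.
by move: xcd; rewrite notin_setE /= in_itv/= => /negP.
Qed.

Lemma Rintegral_plateau_cvg g a b : a < b -> locally_integrable setT g ->
  \int[mu]_x (g x * plateau n.+1%:R a b x) @[n --> \oo] -->
  \int[mu]_(x in `[a, b]) g x.
Proof.
move=> ab lg.
have ig := integrable_itv a (b + 2) lg.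
have mg : measurable_fun `[a, b + 2] g.
  by case: lg => mg _ _; exact: measurable_funS mg.
have -> : \int[mu]_(x in `[a, b]) g x =
    \int[mu]_(x in `[a, b + 2]) (g x * \1_(`]a, b]%classic) x).
  rewrite -Rintegral_itv_obnd_cbnd//; last first.
    apply: integrableS (integrable_itv a b lg) => //.
    exact: subset_itv_oc_cc.
  rewrite Rintegral_mkcond [RHS]Rintegral_mkcond.
  apply: eq_Rintegral => x _; rewrite !patchE indicE.
  case: ifPn => [xab|]; last by rewrite mulr0 if_same.
  rewrite mulr1 ifT// inE; move: xab; rewrite inE/= !in_itv/= => /andP[ax xb].
  by rewrite ltW//= (le_trans xb)// lerDl.
have supp n : \int[mu]_x (g x * plateau n.+1%:R a b x) =
    \int[mu]_(x in `[a, b + 2]) (g x * plateau n.+1%:R a b x).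
  apply: Rintegral_support => x; rewrite negb_and -!ltNge => /orP xo.
  by rewrite plateau_out ?mulr0//; case: xo => /ltW; [left|right].
under eq_cvg do rewrite supp.
have mI : measurable (`]a, b]%classic : set R) by exact: measurable_itv.
have iL : mu.-integrable `[a, b + 2]
    (EFin \o (fun x => g x * \1_(`]a, b]%classic) x)).
  apply: le_integrable ig => //=.
    by apply/measurable_EFinP; apply: measurable_funM.
  move=> x _ /=; rewrite lee_fin normrM indicE.
  by case: (x \in _); rewrite ?normr1 ?normr0 ?mulr1// mulr0.
apply: fine_cvg.
rewrite /Rintegral fineK; last exact: integrable_fin_num.
apply: (@dominated_cvg _ _ _ mu `[a, b + 2] _
  (fun n x => (g x * plateau n.+1%:R a b x)%:E)
  (fun x => (g x * \1_(`]a, b]%classic) x)%:E) (fun x => `|g x|%:E)) => //.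
- move=> n; apply/measurable_EFinP; apply: measurable_funM => //.
  apply: measurable_funTS; apply: continuous_measurable_fun.
  exact: plateau_continuous.
- move=> x _; apply: cvg_EFin; first exact: nearW.
  by apply: cvgM; [exact: cvg_cst|exact: plateau_cvg].
- exact: (integrable_norm ig).
- move=> n x _; rewrite lee_fin normrM ler_piMr//.
  exact: plateau_norm.
Qed.

(** Test the weak derivative against plateaus: their derivatives are two hats
    that concentrate at a and b and yield f a - f b, while the plateaus
    themselves converge to the indicator function of ]a, b]. *)
Lemma weak_derivative_FTC f g a b : continuous f -> weak_derivative f g ->
  a < b -> f b - f a = \int[mu]_(x in `[a, b]) g x.
Proof.
move=> cf [_ lg fg] ab.
have L1 := Rintegral_plateau_cvg ab lg.
have L2 : (- \int[mu]_x (g x * plateau n.+1%:R a b x)) @[n --> \oo] -->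
    f a - f b.
  apply/cvgrPdist_le => e e0.
  have e20 : 0 < e / 2 by rewrite divr_gt0.
  have b2 : b < b + 3 by rewrite ltrDl.
  have a2 : a < b + 3 by rewrite (lt_trans ab).
  near=> n.
  rewrite -(fg _ (plateau_test n ab)) (@Rintegral_support _ a (b + 3)); last first.
    move=> x; rewrite negb_and -!ltNge plateau_derive1 => xo.
    have n1 : 1 <= n.+1%:R :> R by rewrite ler1n.
    rewrite !tent_out ?subrr ?mulr0 ?subrr ?mulr0//.
      by case/orP : xo => ?; [left; nra|right; nra].
    by case/orP : xo => ?; [left; nra|right; nra].
  have ct p : continuous (fun x => f x * (n.+1%:R * tent (n.+1%:R * (x - p)))).
    by move=> x; apply: cvgM; [exact: cf|exact: tent_continuous].
  rewrite plateau_derive1; under eq_Rintegral do rewrite mulrBr.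
  rewrite RintegralB//; try exact: continuous_integrable.
  have A : `|\int[mu]_(x in `[a, b + 3])
      (f x * (n.+1%:R * tent (n.+1%:R * (x - a)))) - f a| <= e / 2.
    near: n; exact: tent_approx_id.
  have B : `|\int[mu]_(x in `[a, b + 3])
      (f x * (n.+1%:R * tent (n.+1%:R * (x - b)))) - f b| <= e / 2.
    near: n; apply: tent_approx_id => //; exact: ltW.
  move: A B; rewrite !ler_norml => /andP[? ?] /andP[? ?]; apply/andP; split; lra.
have L3 : (- \int[mu]_x (g x * plateau n.+1%:R a b x)) @[n --> \oo] -->
    - \int[mu]_(x in `[a, b]) g x by exact: cvgN.
have E := cvg_unique (@Rhausdorff R) L2 L3.
by rewrite -[RHS]opprK -E opprB.
Unshelve. all: by end_near. Qed.

(** Since f is a primitive of g, this is Lebesgue's differentiation theorem. *)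
Lemma weak_derivative_ae f g : continuous f -> weak_derivative f g ->
  {ae mu, forall x, is_derive x 1 f (g x)}.
Proof.
move=> cf wfg; have lg : locally_integrable setT g by case: wfg.
have := lebesgue_differentiation lg.
apply: filterS; first exact: (ae_filter_ringOfSetsType mu).
move=> x gx.
have x1 : x < x + 1 by rewrite ltrDl.
have := @FTC1_lebesgue_pt _ g (BLeft (x - 1)) x (x + 1) x1.
case; [exact: integrable_itv| by rewrite /= lte_fin ltrBlDr|exact: gx|].
set F := (F in derivable F _ _) => dF F'.
have isF : is_derive x 1 (fun y => F y + f (x - 1)) (g x).
  rewrite -[g x]addr0 -F' derive1E; apply: is_deriveD; exact/derivableP.
apply: (@is_derive_approx _ _ _ _) => e e0.
have := is_derive_approxE isF e0.
apply: filterS2 (nbhsx_ballx x 1 ltr01) => y.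
rewrite -ball_normE/= => xy.
have yl : x - 1 < y by move: xy; rewrite ltr_norml => /andP[_]; rewrite ltrBlDr ltrBlDl addrC.
have xl : x - 1 < x by rewrite ltrBlDr.
by rewrite /F -(weak_derivative_FTC cf wfg yl) -(weak_derivative_FTC cf wfg xl) !subrK.
Qed.

End WeakFTC.

(** * Bounds carried by weak derivatives and norms *)

Section WeakBounds.
Context {R : realType}.
Local Notation mu := (@lebesgue_measure R).
Implicit Types (f g w q : R -> R) (a b c d x y k p M K e : R).

Lemma ae_imp (P Q : R -> Prop) : (forall x, P x -> Q x) ->
  {ae mu, forall x, P x} -> {ae mu, forall x, Q x}.
Proof. by move=> PQ; apply: filterS PQ; exact: (ae_filter_ringOfSetsType mu). Qed.

Lemma ae_imp2 (P Q S : R -> Prop) : (forall x, P x -> Q x -> S x) ->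
  {ae mu, forall x, P x} -> {ae mu, forall x, Q x} -> {ae mu, forall x, S x}.
Proof. by move=> PQ; apply: filterS2 PQ; exact: (ae_filter_ringOfSetsType mu). Qed.

Definition Lip M f := forall x y, `|f x - f y| <= M * `|x - y|.

Lemma lipschitz_of_lt M f :
  (forall x y, x < y -> `|f y - f x| <= M * (y - x)) -> Lip M f.
Proof.
move=> H x y; case: (ltgtP x y) => [xy|yx|->].
- by rewrite distrC (distrC x) [`|y - x|]gtr0_norm ?subr_gt0//; exact: H.
- by rewrite [`|x - y|]gtr0_norm ?subr_gt0//; exact: H.
- by rewrite !subrr normr0 mulr0.
Qed.

Lemma Rintegral_ae_bound g a b M : a <= b ->
  mu.-integrable `[a, b] (EFin \o g) -> {ae mu, forall x, `|g x| <= M} ->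
  `|\int[mu]_(x in `[a, b]) g x| <= M * (b - a).
Proof.
move=> ab ig gM; have M0 : 0 <= M.
  have [x _] := ae_in_itv (@ltr01 R) gM; exact: le_trans.
rewrite -lee_fin EFin_normr_Rintegral//.
apply: (le_trans (le_abse_integral _ _ _)) => //; first exact: measurable_int ig.
apply: (@le_trans _ _ (\int[mu]_(x in `[a, b]) (cst M%:E x))%E).
  apply: ae_ge0_le_integral => //.
  - by apply: measurableT_comp => //; exact: measurable_int ig.
  - by move: gM; apply: ae_imp => x gx _; rewrite /= lee_fin.
rewrite integral_cst//= lebesgue_measure_itv/= lte_fin.
case: ifPn => [_|_]; first by rewrite -EFinB -EFinM.
by rewrite mule0 lee_fin mulr_ge0// subr_ge0.
Qed.

Lemma weak_derivative_lipschitz f g M : continuous f -> weak_derivative f g ->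
  {ae mu, forall x, `|g x| <= M} -> Lip M f.
Proof.
move=> cf wfg gM; apply: lipschitz_of_lt => x y xy.
rewrite (weak_derivative_FTC cf wfg xy); apply: Rintegral_ae_bound => //.
  exact: ltW.
by apply: integrable_itv; case: wfg.
Qed.

Lemma lipschitz_derive_bound f x d K : Lip K f -> is_derive x 1 f d ->
  `|d| <= K.
Proof.
move=> Kf /is_derive_approxE H; apply/ler_addgt0Pr => e e0.
have /nbhs_ballP[r /= r0 xr] := H e e0.
have := xr (x + r / 2); rewrite -ball_normE /= opprD addrA subrr sub0r normrN.
have r2 : 0 < r / 2 by rewrite divr_gt0.
rewrite gtr0_norm// => /(_ _).
rewrite ltr_pdivrMr// ltr_pMr// ltr1n => /(_ erefl).
rewrite (_ : x + r / 2 - x = r / 2); last by ring.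
rewrite (gtr0_norm r2) => xd.
have := Kf (x + r / 2) x; rewrite (_ : x + r / 2 - x = r / 2); last by ring.
rewrite (gtr0_norm r2) => xK.
rewrite -(ler_pM2r r2) -{1}(gtr0_norm r2) -normrM.
rewrite (_ : d * (r / 2) = f (x + r / 2) - f x -
  (f (x + r / 2) - f x - d * (r / 2))); last by ring.
apply: le_trans (ler_normB _ _) _; rewrite mulrDl; exact: lerD.
Qed.

Lemma weak_derivative_bound f g K : continuous f -> weak_derivative f g ->
  Lip K f -> {ae mu, forall x, `|g x| <= K}.
Proof.
move=> cf wfg Kf; have := weak_derivative_ae cf wfg.
apply: ae_imp.
move=> x; exact: lipschitz_derive_bound.
Qed.

(** Both weak derivatives are classical derivatives almost everywhere, where
    the product rule applies. *)
Lemma weak_derivative_sqr f g q : continuous f -> weak_derivative f g ->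
  weak_derivative (fun x => f x ^+ 2) q ->
  {ae mu, forall x, q x = 2 * (f x * g x)}.
Proof.
move=> cf wfg wq; have cf2 : continuous (fun x => f x ^+ 2).
  by move=> x; apply: cvgM; exact: cf.
have := weak_derivative_ae cf2 wq; have := weak_derivative_ae cf wfg.
apply: ae_imp2.
move=> x fg fq.
have fM := is_deriveM fg fg.
have E := @derive_val _ _ _ _ _ _ _ fM.
rewrite -(@derive_val _ _ _ _ _ _ _ fq).
have -> : (fun x0 => f x0 ^+ 2) = f * f by apply/funext => z; rewrite expr2.
by rewrite E /GRing.scale /=; ring.
Qed.

Lemma normoo_ae f M : (normoo f <= M%:E)%E -> {ae mu, forall x, `|f x| <= M}.
Proof.
rewrite /normoo unlock; case: ifPn; last first.
  by rewrite -set_itvNyy/= lebesgue_measure_itv/= addye// ltry.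
move=> _ h; have := ess_supP h; apply: ae_imp.
by move=> x /=; rewrite lee_fin.
Qed.

(** The bound is M + 1 and not M because the infimum that defines the norm is
    only approached by the chosen weak derivative. *)
Lemma norm_W1oo_bounds f M : continuous f -> (norm_W1oo f <= M%:E)%E ->
  (forall x, `|f x| <= M + 1) /\ Lip (M + 1) f.
Proof.
move=> cf fM.
have : (norm_W1oo f < (M + 1)%:E)%E.
  by rewrite (le_lt_trans fM)// lte_fin ltrDl.
move=> /ereal_inf_lt[_ [g [wfg ->]] fgM].
split.
- have fae : {ae mu, forall x, `|f x| <= M + 1}.
    apply: normoo_ae; apply: le_trans (ltW fgM); rewrite leeDl//.
    exact: Lnorm_ge0.
  move=> x; rewrite leNgt; apply/negP => fx.
  have cn : (fun z => `|f z|) @ x --> `|f x| by apply: cvg_norm; exact: cf.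
  have nx : \forall z \near x, M + 1 < `|f z| by exact: cvgr_gt cn _ fx.
  have [r /= r0 xr] := (nbhs_ballP _ _).1 nx.
  have xr2 : x < x + r by rewrite ltrDl.
  have [y /andP[xy yr]] := ae_in_itv xr2 fae.
  rewrite leNgt => /negP; apply; apply: xr; rewrite -ball_normE /=.
  by rewrite ltr0_norm ?subr_lt0// opprB ltrBlDl.
- apply: weak_derivative_lipschitz cf wfg _.
  apply: normoo_ae; apply: le_trans (ltW fgM); rewrite leeDr//.
  exact: Lnorm_ge0.
Qed.

(** Cauchy-Schwarz against the indicator function of [a, b]: convergence in L^2
    gives convergence of the integrals over intervals. *)
Lemma norm2_Rintegral a b : exists C, forall w e, measurable_fun setT w ->
  (norm2 w <= e%:E)%E ->
  mu.-integrable `[a, b] (EFin \o w) /\ `|\int[mu]_(x in `[a, b]) w x| <= C * e.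
Proof.
set I : set R := `[a, b]%classic.
have mI : measurable I by exact: measurable_itv.
have mi : measurable_fun setT (\1_I : R -> R) by exact: measurable_indic.
pose N : \bar R := norm2 \1_I.
have Nfin : (N < +oo)%E.
  rewrite /N /norm2 unlock; apply: poweR_lty.
  rewrite (_ : (fun x => _) = (EFin \o \1_I)); last first.
    apply/funext => x /=; rewrite indicE.
    by case: (x \in I); rewrite ?normr1 ?normr0 ?powR1// powR0.
  rewrite integral_indic// setIT /= lebesgue_measure_itv/=.
  by case: ifP => _; rewrite ?ltry// -EFinB ltry.
have N0 : (0 <= N)%E by exact: Lnorm_ge0.
exists (fine N) => w e mw we.
have H : (\int[mu]_(x in I) `|w x|%:E <= (fine N * e)%:E)%E.
  have c2 : 2^-1 + 2^-1 = 1 :> R by rewrite -div1r -splitr.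
  have := @hoelder _ _ _ mu w \1_I 2 2 mw mi (ltr0Sn _ _) (ltr0Sn _ _) c2.
  rewrite Lnorm1 => h; apply: (le_trans (le_trans _ h)).
  - rewrite [leLHS]integral_mkcond; apply: ge0_le_integral => //.
    + by move=> x _; rewrite erestrict_ge0.
    + apply/(measurable_restrictT _ _).1 => //; apply/measurable_EFinP.
      by apply: measurableT_comp => //; exact: measurable_funTS.
    + apply: measurableT_comp => //; apply/measurable_EFinP.
      exact: measurable_funM.
    + move=> x _; rewrite patchE /= indicE; case: ifPn => xI.
        by rewrite mulr1.
      by rewrite mulr0 normr0.
  - rewrite mulrC EFinM fineK ?ge0_fin_numE//.
    exact: lee_wpmul2r.
have iw : mu.-integrable I (EFin \o w).
  apply/integrableP; split; last exact: le_lt_trans H (ltry _).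
  by apply/measurable_EFinP; exact: measurable_funTS.
split => //; rewrite -lee_fin EFin_normr_Rintegral//; apply: le_trans H.
apply: le_abse_integral => //; exact: measurable_int iw.
Qed.

End WeakBounds.

(** * The convolution kernel of the inverse Helmholtz operator *)

Section HelmholtzKernel.
Context {R : realType}.
Local Notation mu := (@lebesgue_measure R).
Implicit Types (f g w q : R -> R) (a b c d x y k p K e rho : R).

Definition ker x y : R := expR (- `|x - y|).

Lemma ker_ge0 x y : 0 <= ker x y. Proof. exact: expR_ge0. Qed.

Lemma ker_continuous x : continuous (ker x).
Proof.
move=> y; apply: (@continuous_comp _ _ _ (fun z => - `|x - z|) expR);
  last exact: continuous_expR.
apply: continuousN; apply: cvg_norm.
by apply: cvgB => //; exact: cvg_cst.
Qed.

Lemma integral_ker0 : (\int[mu]_y (ker 0 y)%:E = 2%:E)%E.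
Proof.
rewrite ge0_symfun_integralT.
- have -> : [set x : R | (0 <= x)%R] = `[0, +oo[%classic.
    by apply/seteqP; split => x /=; rewrite in_itv/= andbT.
  have -> : (\int[mu]_(x in `[0%R, +oo[) (ker 0 x)%:E =
             \int[mu]_(x in `[0%R, +oo[) (expR (- x))%:E)%E.
    apply: eq_integral => x; rewrite inE/= in_itv/= andbT => x0.
    by rewrite /ker sub0r normrN ger0_norm.
  have dE (x : R) : is_derive x 1 (fun z : R => - expR (- z)) (expR (- x)).
    apply: is_derive_eq.
    by rewrite /GRing.scale /=; ring.
  have cE (f : R -> R) : (forall x, derivable f x 1) -> continuous f.
    by move=> df x; apply: differentiable_continuous; apply/derivable1_diffP.
  have cN : continuous (fun z : R => - expR (- z)).
    by apply: cE => x; exact: (@ex_derive _ _ _ _ _ _ _ (dE x)).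
  rewrite (@ge0_continuous_FTC2y _ _ (fun z => - expR (- z)) 0 0).
  + by rewrite oppr0 expR0 -EFinB sub0r opprK -EFinM mulr1.
  + by move=> x _; exact: expR_ge0.
  + apply: continuous_subspaceT; apply: cE => x.
    by apply: ex_derive.
  + by rewrite -[X in _ --> X]oppr0; apply: cvgN; exact: cvgr_expR.
  + by move=> x _; exact: (@ex_derive _ _ _ _ _ _ _ (dE x)).
  + exact: cvg_at_right_filter (cN 0).
  + by move=> x _; rewrite derive1E (@derive_val _ _ _ _ _ _ _ (dE x)).
- by move=> x; exact: ker_ge0.
- exact: ker_continuous.
- by move=> x; rewrite /ker /= !sub0r !normrN.
Qed.

Lemma integral_ker x : (\int[mu]_y (ker x y)%:E = 2%:E)%E.
Proof.
rewrite -integral_ker0.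
have d1 (y : R) : is_derive y 1 (fun z => z - x) 1.
  by apply: is_derive_eq; rewrite subr0.
have d1E : derive1 (fun z : R => z - x) = cst 1.
  by apply/funext => y; rewrite derive1E (@derive_val _ _ _ _ _ _ _ (d1 y)).
rewrite [RHS](@increasing_ge0_integration_by_substitutionT _ (fun z => z - x)).
- rewrite d1E; apply: eq_integral => y _.
  by rewrite /= /GRing.mul /= mulr1 /ker sub0r normrN distrC.
- by move=> a b ab; rewrite ltrD2r.
- by rewrite d1E; exact: cst_continuous.
- by rewrite d1E; exact: is_cvg_cst.
- by rewrite d1E; exact: is_cvg_cst.
- by move=> y; exact: (@ex_derive _ _ _ _ _ _ _ (d1 y)).
- apply/cvgrNyPle => A; near=> z; rewrite lerBlDr; near: z.
  by apply: nbhs_ninfty_le; exact: num_real.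
- apply/cvgryPge => A; near=> z; rewrite lerBrDr; near: z.
  by apply: nbhs_pinfty_ge; exact: num_real.
- exact: ker_continuous.
- exact: ker_ge0.
Unshelve. all: by end_near. Qed.

Lemma ker_integrable x : mu.-integrable setT (EFin \o ker x).
Proof.
apply/integrableP; split.
  by apply/measurable_EFinP; apply: continuous_measurable_fun; exact: ker_continuous.
have -> : (\int[mu]_y `|(EFin \o ker x) y| = \int[mu]_y (ker x y)%:E)%E.
  by apply: eq_integral => y _; rewrite /= (ger0_norm (ker_ge0 x y)).
by rewrite integral_ker ltry.
Qed.

(** Used with a combination w of kernels that is small, like [alpha], far from
    their kinks and merely bounded, by [beta], on a short interval [c, d]
    around them. *)
Lemma kernel_bound q w x0 c d alpha beta K :
  measurable_fun setT q -> {ae mu, forall y, `|q y| <= K} ->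
  measurable_fun setT w -> c <= d -> 0 <= alpha -> 0 <= beta ->
  (forall y, `|w y| <= alpha * ker x0 y + beta * \1_(`[c, d]%classic) y) ->
  mu.-integrable setT (EFin \o (fun y => w y * q y)) /\
  `|\int[mu]_y (w y * q y)| <= K * (2 * alpha + beta * (d - c)).
Proof.
move=> mq qK mw cd a0 b0 wb.
have K0 : 0 <= K.
  have [x _] := ae_in_itv (@ltr01 R) qK; exact: le_trans.
have mI : measurable (`[c, d]%classic : set R) by exact: measurable_itv.
pose B y : R := alpha * ker x0 y + beta * \1_(`[c, d]%classic) y.
have mk : measurable_fun setT (ker x0).
  by apply: continuous_measurable_fun; exact: ker_continuous.
have iI : mu.-integrable setT (EFin \o (\1_(`[c, d]%classic) : R -> R)).
  exact: integrable_indic_itv.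
have iB1 : mu.-integrable setT (EFin \o (fun y => alpha * ker x0 y)).
  exact: (integrableZl _ alpha (ker_integrable x0)).
have iB2 : mu.-integrable setT (EFin \o (fun y => beta * \1_(`[c, d]%classic) y)).
  exact: (integrableZl _ beta iI).
have iB : mu.-integrable setT (EFin \o B) by exact: integrableD iB1 iB2.
have mwq : measurable_fun setT (fun y => w y * q y) by exact: measurable_funM.
have B0 y : 0 <= B y.
  by rewrite addr_ge0// mulr_ge0// ?ker_ge0// indicE.
have H : (\int[mu]_y `|(w y * q y)%:E| <= \int[mu]_y (K * B y)%:E)%E.
  apply: ae_ge0_le_integral => //.
  - by apply: measurableT_comp => //; exact/measurable_EFinP.
  - by move=> y _; rewrite lee_fin mulr_ge0.
  - apply/measurable_EFinP; apply: measurable_funM => //.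
    by apply/measurable_EFinP; exact: measurable_int iB.
  - move: qK; apply: ae_imp => y qy _; rewrite lee_fin normrM mulrC ler_pM//.
have E : (\int[mu]_y (K * B y)%:E = (K * (2 * alpha + beta * (d - c)))%:E)%E.
  have ZE r f : mu.-integrable setT (EFin \o f) ->
      (\int[mu]_y (r * f y)%:E = r%:E * \int[mu]_y (f y)%:E)%E.
    by move=> jf; under eq_integral do rewrite EFinM; exact: integralZl.
  rewrite ZE// EFinM; congr (_ * _)%E.
  rewrite [LHS](integralD_EFin _ iB1 iB2)// EFinD; congr (_ + _)%E.
    rewrite [LHS](ZE alpha _ (ker_integrable x0)) integral_ker -EFinM.
    by rewrite mulrC.
  rewrite [LHS](ZE beta _ iI) EFinM; congr (_ * _)%E.
  rewrite integral_indic// setIT /= lebesgue_measure_itv/= lte_fin.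
  case: ifPn => [_|]; first by rewrite -EFinB.
  by rewrite -leNgt => dc; rewrite (_ : d = c) ?subrr//; apply/le_anti/andP.
have iwq : mu.-integrable setT (EFin \o (fun y => w y * q y)).
  apply/integrableP; split; first exact/measurable_EFinP.
  by apply: le_lt_trans H _; rewrite E ltry.
split => //; rewrite -lee_fin EFin_normr_Rintegral// -E.
by apply: le_trans H; apply: le_abse_integral => //; exact: measurable_int iwq.
Qed.

End HelmholtzKernel.

(** * Difference quotients of the nonlocal term *)

Section HelmholtzSlope.
Context {R : realType}.
Local Notation mu := (@lebesgue_measure R).
Implicit Types (f g w q : R -> R) (a b c d x y k p K e rho : R).

(** Near 0 the derivative of [expR] differs from 1 by at most 2 rho; the
    restriction rho <= 1/2 makes 1 / (1 - rho) <= 1 + 2 rho. *)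
Lemma expR_strict_deriv rho a b : rho <= 2^-1 -> `|a| <= rho -> `|b| <= rho ->
  `|expR a - expR b - (a - b)| <= 2 * rho * `|a - b|.
Proof.
move=> r2; wlog ba : a b / b <= a.
  move=> H ar br; have [|/ltW] := leP b a; first by move=> /H; apply.
  move=> /H/(_ br ar); rewrite -normrN (distrC b a).
  by congr (`|_| <= _); ring.
rewrite !ler_norml => /andP[a1 a2] /andP[b1 b2].
rewrite (ger0_norm (_ : 0 <= a - b)) ?subr_ge0//.
have ea0 := expR_gt0 a; have eb0 := expR_gt0 b.
have eb1 := expR_ge1Dx b.
have ab := expR_ge1Dx (a - b); have bba := expR_ge1Dx (b - a).
have eab : expR a = expR b * expR (a - b) by rewrite -expRD; congr expR; ring.
have eba : expR b = expR a * expR (b - a) by rewrite -expRD; congr expR; ring.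
have ea2 : expR a <= 1 + 2 * rho.
  have := expR_ge1Dx (- a); have : expR a * expR (- a) = 1.
    by rewrite -expRD subrr expR0.
  move: (expR (- a)) => z Ez Hz.
  have : expR a * (1 - rho) <= 1.
    by rewrite -Ez (ler_wpM2l (ltW ea0))//; lra.
  by move=> ?; nra.
have L : expR b * (1 + (a - b)) <= expR a by rewrite eab (ler_wpM2l (ltW eb0)).
have U : expR a * (1 + (b - a)) <= expR b by rewrite eba (ler_wpM2l (ltW ea0)).
apply/andP; split; nra.
Qed.

Lemma ker_lipschitz y x1 x2 : `|ker x1 y - ker x2 y| <= `|x1 - x2|.
Proof.
wlog h : x1 x2 / `|x1 - y| <= `|x2 - y|.
  move=> H; have [/H//|/ltW/H] := leP `|x1 - y| `|x2 - y|.
  by rewrite distrC (distrC x2).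
have tri : `|x2 - y| - `|x1 - y| <= `|x1 - x2|.
  have := ler_normB (x1 - y) (x1 - x2).
  rewrite (_ : x1 - y - (x1 - x2) = x2 - y); last by ring.
  by lra.
apply: le_trans tri; rewrite /ker.
move: h (normr_ge0 (x1 - y)); move: `|x1 - y| `|x2 - y| => a b ab a0.
have e : expR (- b) <= expR (- a) by rewrite ler_expR lerN2.
rewrite ger0_norm ?subr_ge0//.
have E : expR (- b) = expR (- a) * expR (a - b) by rewrite -expRD; congr expR; ring.
have l := expR_ge1Dx (a - b).
have u : expR (- a) <= 1 by rewrite expR_le1 oppr_le0.
have p := expR_gt0 (- a).
have : expR (- a) * (1 + (a - b)) <= expR (- b) by rewrite E (ler_wpM2l (ltW p)).
by move=> ?; nra.
Qed.

(** Off the kink, x |-> ker x y is the exponential of s x up to a factor, with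
    s = 1 or -1, so its difference quotients at scale rho all lie within
    2 rho ker x0 y of s ker x0 y. *)
Lemma ker_slope_far x0 rho x1 x2 x3 x4 y : rho <= 2^-1 ->
  `|x1 - x0| <= rho -> `|x2 - x0| <= rho ->
  `|x3 - x0| <= rho -> `|x4 - x0| <= rho -> rho < `|y - x0| ->
  `|(ker x1 y - ker x2 y) * (x3 - x4) - (ker x3 y - ker x4 y) * (x1 - x2)|
    <= 4 * rho * ker x0 y * (`|x1 - x2| * `|x3 - x4|).
Proof.
move=> r2 h1 h2 h3 h4 hy.
have [s sE [Hs sN]] : exists2 s : R, s ^+ 2 = 1 &
    (forall x, `|x - x0| <= rho -> ker x y = ker x0 y * expR (s * (x - x0))) /\
    `|s| = 1.
  have [xy|yx] := leP x0 y.
    exists 1; rewrite ?expr1n// normr1; split=> // x.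
    move: hy; rewrite ger0_norm ?subr_ge0// ler_norml => hy /andP[_ xr].
    rewrite /ker !ler0_norm ?subr_le0//; last by lra.
    by rewrite -expRD; congr expR; ring.
  exists (- 1); rewrite ?sqrrN ?expr1n// normrN1; split=> // x.
  move: hy; rewrite ltr0_norm ?subr_lt0// ler_norml => hy /andP[xr _].
  rewrite /ker !ger0_norm ?subr_ge0 ?(ltW yx)//; last by lra.
  by rewrite -expRD; congr expR; ring.
rewrite (Hs _ h1) (Hs _ h2) (Hs _ h3) (Hs _ h4) -!mulrBr.
have k0 := ker_ge0 x0 y.
have A x x' : `|x - x0| <= rho -> `|x' - x0| <= rho ->
  `|expR (s * (x - x0)) - expR (s * (x' - x0)) - s * (x - x')| <= 2 * rho * `|x - x'|.
  move=> hx hx'; have := @expR_strict_deriv rho (s * (x - x0)) (s * (x' - x0)) r2.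
  rewrite !normrM sN !mul1r => /(_ hx hx').
  rewrite (_ : s * (x - x0) - s * (x' - x0) = s * (x - x')); last by ring.
  by rewrite normrM sN mul1r.
pose u := expR (s * (x1 - x0)) - expR (s * (x2 - x0)) - s * (x1 - x2).
pose v := expR (s * (x3 - x0)) - expR (s * (x4 - x0)) - s * (x3 - x4).
have e1 : `|u| <= 2 * rho * `|x1 - x2| := A _ _ h1 h2.
have e3 : `|v| <= 2 * rho * `|x3 - x4| := A _ _ h3 h4.
have -> : ker x0 y * (expR (s * (x1 - x0)) - expR (s * (x2 - x0))) * (x3 - x4)
    - ker x0 y * (expR (s * (x3 - x0)) - expR (s * (x4 - x0))) * (x1 - x2)
  = ker x0 y * (u * (x3 - x4) - v * (x1 - x2)) by rewrite /u /v; ring.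
rewrite normrM (ger0_norm k0).
rewrite (_ : 4 * rho * ker x0 y * _ =
  ker x0 y * (4 * rho * (`|x1 - x2| * `|x3 - x4|))); last by ring.
apply: (ler_wpM2l k0).
apply: (le_trans (ler_normB _ _)); rewrite !normrM.
have n1 := normr_ge0 (x1 - x2); have n3 := normr_ge0 (x3 - x4).
have := ler_wpM2r n3 e1; have := ler_wpM2r n1 e3; lra.
Qed.

Lemma ker_slope_bound x0 rho x1 x2 x3 x4 y : rho <= 2^-1 -> 0 <= rho ->
  `|x1 - x0| <= rho -> `|x2 - x0| <= rho ->
  `|x3 - x0| <= rho -> `|x4 - x0| <= rho ->
  `|(ker x1 y - ker x2 y) * (x3 - x4) - (ker x3 y - ker x4 y) * (x1 - x2)|
    <= 4 * rho * (`|x1 - x2| * `|x3 - x4|) * ker x0 y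
       + 2 * (`|x1 - x2| * `|x3 - x4|) * \1_(`[x0 - rho, x0 + rho]%classic) y.
Proof.
move=> r2 r0 h1 h2 h3 h4.
have p0 : 0 <= `|x1 - x2| * `|x3 - x4| by rewrite mulr_ge0.
have k0 := ker_ge0 x0 y.
rewrite indicE; case: (boolP (_ \in _)).
  move=> _; rewrite mulr1; apply: (le_trans (ler_normB _ _)); rewrite !normrM.
  have := ler_wpM2r (normr_ge0 (x3 - x4)) (ker_lipschitz y x1 x2).
  have := ler_wpM2r (normr_ge0 (x1 - x2)) (ker_lipschitz y x3 x4).
  have : 0 <= 4 * rho * (`|x1 - x2| * `|x3 - x4|) * ker x0 y.
    by rewrite !mulr_ge0.
  lra.
rewrite notin_setE /= in_itv/= => /negP; rewrite -ler_distl -ltNge => hy.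
rewrite mulr0 addr0 (_ : _ * ker x0 y =
  4 * rho * ker x0 y * (`|x1 - x2| * `|x3 - x4|)); last by ring.
exact: (ker_slope_far r2 h1 h2 h3 h4 hy).
Qed.

Lemma helmholtz_inv_integrable q x K : measurable_fun setT q ->
  {ae mu, forall y, `|q y| <= K} ->
  mu.-integrable setT (EFin \o (fun y => ker x y * q y)) /\
  `|helmholtz_inv q x| <= K.
Proof.
move=> mq qK.
have mk : measurable_fun setT (ker x).
  by apply: continuous_measurable_fun; exact: ker_continuous.
have := @kernel_bound _ q (ker x) x x x 1 0 K mq qK mk (lexx x) ler01 (lexx 0).
case=> [y|iq le]; first by rewrite mul1r mul0r addr0 (ger0_norm (ker_ge0 x y)).
split=> //; rewrite /helmholtz_inv normrM ger0_norm//.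
by move: le; rewrite /ker; lra.
Qed.

(** The derivative of e^(-|x|) jumps at the kink only, so the difference
    quotients of the kernel are almost equal outside an interval of length
    2 rho and bounded inside it; integrating against a bounded q leaves an
    error of order rho.  Multiplying out the denominators x1 - x2 and x3 - x4
    spares assuming them nonzero. *)
Lemma helmholtz_inv_slope q x0 rho x1 x2 x3 x4 K : measurable_fun setT q ->
  {ae mu, forall y, `|q y| <= K} -> rho <= 2^-1 -> 0 <= rho ->
  `|x1 - x0| <= rho -> `|x2 - x0| <= rho ->
  `|x3 - x0| <= rho -> `|x4 - x0| <= rho ->
  `|(helmholtz_inv q x1 - helmholtz_inv q x2) * (x3 - x4)
    - (helmholtz_inv q x3 - helmholtz_inv q x4) * (x1 - x2)|
    <= 6 * K * rho * (`|x1 - x2| * `|x3 - x4|).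
Proof.
move=> mq qK r2 r0 h1 h2 h3 h4.
set p := `|x1 - x2| * `|x3 - x4|.
have p0 : 0 <= p by rewrite mulr_ge0.
have i x : mu.-integrable setT (EFin \o (fun y => ker x y * q y)).
  by case: (helmholtz_inv_integrable x mq qK).
have iZ r x : mu.-integrable setT (EFin \o (fun y => r * (ker x y * q y))).
  exact: (integrableZl _ r (i x)).
pose w y := (ker x1 y - ker x2 y) * (x3 - x4) - (ker x3 y - ker x4 y) * (x1 - x2).
have mw : measurable_fun setT w.
  apply: continuous_measurable_fun => y.
  have kc x := @ker_continuous R x y.
  by apply: cvgB; apply: cvgM; try exact: cvg_cst; apply: cvgB; exact: kc.
have cd : x0 - rho <= x0 + rho by rewrite lerD2l; lra.
have [_] := @kernel_bound _ q w x0 _ _ (4 * rho * p) (2 * p) K mq qK mw cd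
  ltac:(by rewrite !mulr_ge0) ltac:(by rewrite mulr_ge0)
  (fun y => ker_slope_bound y r2 r0 h1 h2 h3 h4).
have H x : helmholtz_inv q x = 2^-1 * \int[mu]_y (ker x y * q y) by [].
suff -> : \int[mu]_y (w y * q y) =
  2 * ((helmholtz_inv q x1 - helmholtz_inv q x2) * (x3 - x4)
    - (helmholtz_inv q x3 - helmholtz_inv q x4) * (x1 - x2)).
  rewrite normrM ger0_norm//; lra.
have -> : (fun y => w y * q y) = (fun y =>
   ((x3 - x4) * (ker x1 y * q y) - (x3 - x4) * (ker x2 y * q y)) -
   ((x1 - x2) * (ker x3 y * q y) - (x1 - x2) * (ker x4 y * q y))).
  by apply/funext => y; rewrite /w; ring.
rewrite RintegralB//; [|exact: (integrableB _ (iZ _ _) (iZ _ _))..].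
rewrite (RintegralB measurableT (iZ _ x1) (iZ _ x2)).
rewrite (RintegralB measurableT (iZ _ x3) (iZ _ x4)).
rewrite (RintegralZl _ measurableT (i x1)) (RintegralZl _ measurableT (i x2)).
rewrite (RintegralZl _ measurableT (i x3)) (RintegralZl _ measurableT (i x4)).
rewrite !H.
move: (\int[mu]_y (ker x1 y * q y)) (\int[mu]_y (ker x2 y * q y)) => I1 I2.
move: (\int[mu]_y (ker x3 y * q y)) (\int[mu]_y (ker x4 y * q y)) => I3 I4.
by field.
Qed.

End HelmholtzSlope.

(** * Interval averages and one-sided derivatives in time *)

Section Helpers.
Context {R : realType}.
Local Notation mu := (@lebesgue_measure R).
Implicit Types (f g w q G : R -> R) (a b c d x y s t k p K L M T e rho : R).

Lemma Rintegral_itv_cst a b c : a <= b -> \int[mu]_(x in `[a, b]) c = c * (b - a).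
Proof.
move=> ab; rewrite Rintegral_cst//= lebesgue_measure_itv/= lte_fin.
by case: ltgtP ab => // -> _; rewrite subrr !mulr0.
Qed.

Lemma Rintegral_near_cst f a b c e : continuous f -> a <= b ->
  (forall x, a <= x <= b -> `|f x - c| <= e) ->
  `|\int[mu]_(x in `[a, b]) f x - c * (b - a)| <= e * (b - a).
Proof.
move=> cf ab fc.
have cc (r : R) : continuous ((fun=> r) : R -> R) by exact: cst_continuous.
rewrite -(Rintegral_itv_cst c ab) -RintegralB//; try exact: continuous_integrable.
have cfc : continuous (fun x => f x - c).
  by move=> x; apply: cvgB; [exact: cf|exact: cvg_cst].
apply: (le_trans (le_normr_Rintegral _ _)) => //.
  exact: continuous_integrable.
rewrite -(Rintegral_itv_cst e ab); apply: le_Rintegral.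
- by [].
- by apply: continuous_integrable => x; apply: cvg_norm; exact: cfc.
- exact: continuous_integrable.
- by move=> x /=; rewrite in_itv/=; exact: fc.
Qed.

Lemma lipschitz_continuous K f : Lip K f -> continuous f.
Proof.
move=> Kf x; apply/cvgrPdist_le => e e0.
have K0 : 0 < `|K| + 1 by rewrite ltr_pwDr.
near=> y; apply: le_trans (Kf x y) _.
apply: (@le_trans _ _ ((`|K| + 1) * `|x - y|)).
  by rewrite ler_wpM2r// (le_trans (ler_norm K))// lerDl.
rewrite mulrC -ler_pdivlMr//; near: y.
apply: filterS (nbhsx_ballx x (e / (`|K| + 1)) (divr_gt0 e0 K0)) => y.
by rewrite -ball_normE /= => /ltW.
Unshelve. all: by end_near. Qed.

Lemma Rintegral_lipschitz_avg L f x e : Lip L f -> 0 <= L -> 0 <= e ->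
  `|\int[mu]_(y in `[x, x + e]) f y - f x * e| <= L * e * e.
Proof.
move=> Lf L0 e0; have xe : x <= x + e by rewrite lerDl.
have := @Rintegral_near_cst f x (x + e) (f x) (L * e) (lipschitz_continuous Lf) xe.
rewrite (_ : x + e - x = e); last by ring.
apply=> y /andP[xy ye]; apply: le_trans (Lf y x) _; rewrite ler_wpM2l//.
by rewrite ger0_norm ?subr_ge0// lerBlDl.
Qed.

Lemma Rintegral_continuous_avg f x e : continuous f -> 0 < e ->
  exists2 r, 0 < r & forall d, 0 <= d <= r ->
    `|\int[mu]_(y in `[x, x + d]) f y - f x * d| <= e * d.
Proof.
move=> cf e0; have /cvgrPdist_le/(_ _ e0)[r /= r0 fr] := cf x.
exists (r / 2); first by rewrite divr_gt0.
move=> d /andP[d0 dr]; have xd : x <= x + d by rewrite lerDl.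
have := @Rintegral_near_cst f x (x + d) (f x) e cf xd.
rewrite (_ : x + d - x = d); last by ring.
apply=> y /andP[xy yd]; rewrite distrC; apply: fr => /=.
rewrite ler0_norm ?subr_le0// opprB; move: r0 dr; lra.
Qed.

Lemma itvW T t : t \in `]0, T[ -> t \in `[0, T].
Proof. exact: subset_itv_oo_cc. Qed.

Lemma itv_within_ball T t r : 0 < T -> 0 <= t <= T -> 0 < r ->
  exists a b, a < b /\ forall s, a < s < b -> 0 <= s <= T /\ `|t - s| < r.
Proof.
move=> T0 /andP[t0 tT] r0; have [tT'|Tt] := ltP t T.
  exists t, (Num.min (t + r) T); split.
    by rewrite lt_min tT' ltrDl r0.
  move=> s /andP[ts]; rewrite lt_min => /andP[sr sT]; split; first by lra.
  by rewrite ltr0_norm ?subr_lt0//; lra.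
exists (Num.max (t - r) 0), t; split.
  by rewrite gt_max; apply/andP; split; lra.
move=> s /andP[]; rewrite gt_max => /andP[sr s0] st; split; first by lra.
by rewrite gtr0_norm ?subr_gt0//; lra.
Qed.

(** A null set of times has dense complement in [0, T], hence a bound that holds
    for almost every time passes to all times by continuity. *)
Lemma ae_bound_everywhere T G C : 0 < T ->
  {within `[0, T], continuous G} ->
  {ae mu, forall t, t \in `[0, T] -> `|G t| <= C} ->
  forall t, t \in `[0, T] -> `|G t| <= C.
Proof.
move=> T0 cG aG t tT; rewrite leNgt; apply/negP => Gt.
have /subspace_continuousP/(_ t tT) ct := cG.
have nt : \forall s \near within `[0, T] (nbhs t), C < `|G s|.
  have cn : (fun z => `|G z|) @ within `[0, T] (nbhs t) --> `|G t|.
    exact: cvg_norm.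
  exact: cvgr_gt cn _ Gt.
have [r /= r0 H] := nt.
have tT' : 0 <= t <= T by move: tT; rewrite in_itv.
have [a [b [ab abH]]] := itv_within_ball T0 tT' r0.
have [s sab Gs] := ae_in_itv ab aG.
have [sT sr] := abH _ sab.
have := H s sr; rewrite in_itv/= sT => /(_ isT).
by rewrite ltNge Gs// in_itv.
Qed.

(** The derivative relative to [0, T], one-sided at the end points, in the form
    in which the flow and the time derivative of the solution are given. *)
Definition slope_cvg T f t d : Prop :=
  (f s - f t) / (s - t) @[s --> within `[0, T] t^'] --> d.

Lemma slope_cvg_approx T f t d : slope_cvg T f t d ->
  forall e, 0 < e -> \forall s \near t, s \in `[0, T] ->
    `|f s - f t - d * (s - t)| <= e * `|s - t|.
Proof.
move=> /cvgrPdist_le H e e0.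
have H' : \forall s \near t, s != t -> s \in `[0, T] ->
   `|d - (f s - f t) / (s - t)| <= e by exact: H.
apply: filterS H' => s H' sT.
have [->|st] := eqVneq s t; first by rewrite !subrr mulr0 subrr normr0 mulr0.
have st0 : s - t != 0 by rewrite subr_eq0.
have -> : f s - f t - d * (s - t) = - ((d - (f s - f t) / (s - t)) * (s - t)).
  by field.
by rewrite normrN normrM ler_wpM2r// H'.
Qed.

Lemma slope_cvg_derive T f t d : t \in `]0, T[ -> slope_cvg T f t d ->
  is_derive t 1 f d.
Proof.
move=> tT /slope_cvg_approx H; apply: is_derive_approx => e e0.
near=> s; have : s \in `[0, T] -> `|f s - f t - d * (s - t)| <= e * `|s - t|.
  by near: s; exact: H.
apply; near: s.
have : nbhs t (`]0, T[%classic : set R).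
  by apply: open_nbhs_nbhs; split => //; exact: itv_open.
by apply: filterS => s; apply: subset_itv_oo_cc.
Unshelve. all: by end_near. Qed.

Lemma slope_cvg_continuous T f :
  (forall t, t \in `[0, T] -> exists d, slope_cvg T f t d) ->
  {within `[0, T], continuous f}.
Proof.
move=> H; apply/subspace_continuousP => t tT.
have [d /slope_cvg_approx Hd] := H t tT.
apply/cvgrPdist_le => e e0.
have n1 := Hd 1 ltr01.
have K0 : 0 < `|d| + 1 by rewrite ltr_pwDr.
have n2 := nbhsx_ballx t (e / (`|d| + 1)) (divr_gt0 e0 K0).
suff : \forall s \near t, s \in `[0, T] -> `|f t - f s| <= e by [].
apply: filterS2 n1 n2 => s H1; rewrite -ball_normE /= => sr sT.
have := H1 sT; rewrite mul1r => H2.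
rewrite distrC (_ : f s - f t = (f s - f t - d * (s - t)) + d * (s - t)); last by ring.
apply: (le_trans (ler_normD _ _)); rewrite normrM.
move: sr; rewrite ltr_pdivlMr// distrC; lra.
Qed.

Lemma MVT_bound f df a b C : a <= b ->
  (forall x, x \in `]a, b[ -> is_derive x 1 f (df x)) ->
  {within `[a, b], continuous f} ->
  (forall x, x \in `]a, b[ -> `|df x| <= C) -> `|f b - f a| <= C * (b - a).
Proof.
move=> ab df1 cf dC; move: ab; rewrite le_eqVlt => /predU1P[->|ab].
  by rewrite !subrr normr0 mulr0.
have [c cab ->] := MVT ab df1 cf.
by rewrite normrM (gtr0_norm (_ : 0 < b - a)) ?subr_gt0// ler_pM2r ?subr_gt0// dC.
Qed.

(** Compare the quotient over a short step with the quotient over the step 1/2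
    starting at the same point, which is bounded since [helmholtz_inv q] is. *)
Lemma helmholtz_inv_lipschitz q K : measurable_fun setT q ->
  {ae mu, forall y, `|q y| <= K} -> Lip (7 * K) (helmholtz_inv q).
Proof.
move=> mq qK x1 x2.
have K0 : 0 <= K.
  have [x _] := ae_in_itv (@ltr01 R) qK; exact: le_trans.
have hb x : `|helmholtz_inv q x| <= K.
  by case: (helmholtz_inv_integrable x mq qK).
have h2 x y : `|helmholtz_inv q x - helmholtz_inv q y| <= 2 * K.
  apply: (le_trans (ler_normB _ _)); have := hb x; have := hb y; lra.
have n0 := normr_ge0 (x1 - x2).
have [far|near] := leP 2^-1 `|x1 - x2|.
  by apply: (le_trans (h2 x1 x2)); nra.
have hp : 0 <= 2^-1 :> R by rewrite invr_ge0.
have := @helmholtz_inv_slope R q x1 2^-1 x1 x2 x1 (x1 + 2^-1) K mq qK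
  (lexx _) hp.
rewrite subrr normr0 (distrC x2) (_ : x1 + 2^-1 - x1 = 2^-1); last by ring.
rewrite (ger0_norm hp) => /(_ hp (ltW near) hp (lexx _)).
rewrite (_ : x1 - (x1 + 2^-1) = - 2^-1); last by ring.
rewrite normrN (ger0_norm hp).
have := h2 x1 (x1 + 2^-1).
move: (helmholtz_inv q (x1 + 2^-1)) (helmholtz_inv q x1) (helmholtz_inv q x2).
move=> h3 h1 h4 A B.
have : `|(h1 - h4) * - 2^-1| <= `|(h1 - h4) * - 2^-1 - (h1 - h3) * (x1 - x2)| +
    `|h1 - h3| * `|x1 - x2|.
  rewrite -[in leRHS]normrM; apply: le_trans (ler_normD _ _).
  by rewrite subrK.
rewrite normrM normrN (ger0_norm hp).
have := ler_wpM2r n0 A; lra.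
Qed.

End Helpers.

(** * The transport structure of a solution *)

Section TransportData.
Context {R : realType}.
Local Notation mu := (@lebesgue_measure R).

(** Everything that the study of characteristics needs to know about the
    solution u and its forcing h: regularity in space and time, with a common
    constant C, and the balance law for integrals over fixed intervals.  The
    field [td_hslope] says that h t is C^1 with Lipschitz derivative. *)
Record transport_data (C T : R) (u h : R -> R -> R) : Prop := TransportData {
  td_C : 0 <= C;
  td_bound : forall t x, t \in `[0, T] -> `|u t x| <= C;
  td_space : forall t, t \in `[0, T] -> Lip C (u t);
  td_time : forall s t x, s \in `[0, T] -> t \in `[0, T] ->
    `|u s x - u t x| <= C * `|s - t|;
  td_hspace : forall t, t \in `[0, T] -> Lip C (h t);
  td_htime : forall t x, t \in `[0, T] ->
    h s x @[s --> within `[0, T] (nbhs t)] --> h t x;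
  td_hslope : forall t x0 rho x1 x2 x3 x4, t \in `[0, T] ->
    0 <= rho <= 2^-1 -> `|x1 - x0| <= rho -> `|x2 - x0| <= rho ->
    `|x3 - x0| <= rho -> `|x4 - x0| <= rho ->
    `|(h t x1 - h t x2) * (x3 - x4) - (h t x3 - h t x4) * (x1 - x2)|
      <= C * rho * (`|x1 - x2| * `|x3 - x4|);
  td_box : forall t a b, t \in `[0, T] -> a < b ->
    slope_cvg T (fun s => \int[mu]_(x in `[a, b]) u s x) t
      (- ((u t b ^+ 2 - u t a ^+ 2) / 2) - 3 / 2 * \int[mu]_(x in `[a, b]) h t x)
}.

End TransportData.

(** * Solutions in integro-differential form *)

Section Evolution.
Context {R : realType}.
Local Notation mu := (@lebesgue_measure R).

Lemma L2_Rintegral_cvg (w : R -> R -> R) (F : set_system R) (a b : R) :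
  Filter F -> norm2 (w s) @[s --> F] --> 0%E ->
  (\forall s \near F, measurable_fun setT (w s)) ->
  \int[mu]_(x in `[a, b]) w s x @[s --> F] --> 0.
Proof.
move=> FF w0 mw; have [C HC] := norm2_Rintegral a b.
apply/cvgrPdist_le => e e0.
have C0 : 0 < `|C| + 1 by rewrite ltr_pwDr.
have e1 : (0 < (e / (`|C| + 1))%:E)%E by rewrite lte_fin divr_gt0.
have w1 : \forall s \near F, (norm2 (w s) < (e / (`|C| + 1))%:E)%E.
  exact: (w0 _ (open_ereal_lt' e1)).
apply: filterS2 mw w1 => s ms /ltW ws.
have [_ /le_trans] := HC _ _ ms ws; rewrite sub0r normrN; apply.
apply: (@le_trans _ _ ((`|C| + 1) * (e / (`|C| + 1)))).
  rewrite ler_wpM2r ?ltW ?divr_gt0//.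
  by rewrite (le_lt_trans (ler_norm C))// ltrDl.
by rewrite mulrC divfK// gt_eqF.
Qed.

Lemma L2_measurable (f : R -> R) : L2 f -> measurable_fun setT f.
Proof. by rewrite /L2 inE => /andP[+ _]; rewrite inE. Qed.

Lemma L2_integrable_itv (f : R -> R) a b : L2 f ->
  mu.-integrable `[a, b] (EFin \o f).
Proof.
move=> Lf; have [C HC] := norm2_Rintegral a b.
have fin : norm2 f \is a fin_num.
  rewrite ge0_fin_numE ?Lnorm_ge0//; move: Lf.
  by rewrite /L2 inE => /andP[_]; rewrite inE.
have [] // := HC f (fine (norm2 f)) (L2_measurable Lf).
by rewrite fineK.
Qed.

Context (T : R) (u ut ux q : R -> R -> R).
Context (T0 : 0 < T).
Context (uc : forall t, t \in `[0, T] -> continuous (u t)).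
Context (wux : forall t, t \in `[0, T] ->
  weak_derivative (u t) (ux t) /\ weak_derivative (fun x => u t x ^+ 2) (q t)).
Context (dut : L2_time_derivative `[0, T] u ut).
Context (Cut : C_L2 `[0, T] ut).
Context (Ch : C_L2 `[0, T] (fun t => helmholtz_inv (q t))).
Context (eqn : forall t, t \in `[0, T] -> {ae mu, forall x,
  ut t x + u t x * ux t x + 3 / 2 * helmholtz_inv (q t) x = 0}).
Context (ub : ess_bounded_in norm_W1oo `[0, T] u).

Let h t := helmholtz_inv (q t).

(** Integrals over intervals are continuous linear functionals on L^2, so they
    inherit the differentiability in time of the L^2-valued solution. *)
Lemma box_slope a b t : t \in `[0, T] -> a <= b ->
  slope_cvg T (fun s => \int[mu]_(x in `[a, b]) u s x) t
    (\int[mu]_(x in `[a, b]) ut t x).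
Proof.
move=> tT ab.
have Lut : L2 (ut t) := Cut.1 t tT.
have iut := L2_integrable_itv a b Lut.
have mut := L2_measurable Lut.
have iu s : s \in `[0, T] -> mu.-integrable `[a, b] (EFin \o u s).
  by move=> sT; apply: continuous_integrable; exact: uc.
have mu_ s : s \in `[0, T] -> measurable_fun setT (u s).
  by move=> sT; apply: continuous_measurable_fun; exact: uc.
have FF : Filter (within `[0, T] t^') by exact: within_filter.
have nI : \forall s \near within `[0, T] t^', s \in `[0, T].
  exact: withinT.
have := @L2_Rintegral_cvg (fun s x => (u s x - u t x) / (s - t) - ut t x)
  (within `[0, T] t^') a b FF (dut tT).
move=> H; have mw : \forall s \near within `[0, T] t^', measurable_fun setT
    (fun x => (u s x - u t x) / (s - t) - ut t x).
  apply: filterS nI => s sT; apply: measurable_funB => //.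
  apply: measurable_funM => //.
  by apply: measurable_funB; exact: mu_.
have /cvgrPdist_le H0 := H mw; apply/cvgrPdist_le => e e0.
apply: filterS2 nI (H0 e e0) => s sT.
rewrite sub0r normrN distrC.
suff -> : \int[mu]_(x in `[a, b]) ((u s x - u t x) / (s - t) - ut t x) =
  (\int[mu]_(x in `[a, b]) u s x - \int[mu]_(x in `[a, b]) u t x) / (s - t)
  - \int[mu]_(x in `[a, b]) ut t x by [].
have cst : continuous (fun x => u s x - u t x).
  by move=> x; apply: cvgB; apply: uc.
have ics := continuous_integrable a b cst.
have icst : mu.-integrable `[a, b] (EFin \o (fun x => (u s x - u t x) / (s - t))).
  by apply: continuous_integrable => x; apply: cvgM; [exact: cst|exact: cvg_cst].
rewrite RintegralB//; congr (_ - _).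
rewrite RintegralZr//; congr (_ / _).
by rewrite RintegralB//; exact: iu.
Qed.

Lemma box_continuous a b : a <= b ->
  {within `[0, T], continuous (fun s => \int[mu]_(x in `[a, b]) u s x)}.
Proof.
move=> ab; apply: slope_cvg_continuous => t tT.
by eexists; exact: box_slope.
Qed.

(** The norm in W^(1,oo) is bounded for almost every time only.  The bounds are
    first expressed by integrals over intervals, which are continuous in time
    and thus satisfy them at every time; shrinking the intervals then returns
    to the pointwise values of the continuous profile. *)
Lemma u_bounds : exists2 M, 0 <= M & forall t, t \in `[0, T] ->
  (forall x, `|u t x| <= M) /\ Lip M (u t).
Proof.
have [M0 HM0] := ub; pose M := `|M0 + 1|.
have M_ge0 : 0 <= M by exact: normr_ge0.
have good : {ae mu, forall t, t \in `[0, T] ->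
    (forall x, `|u t x| <= M) /\ Lip M (u t)}.
  move: HM0; apply: ae_imp => t + tT => /(_ tT) W.
  have [bd li] := norm_W1oo_bounds (uc tT) W.
  have MM : M0 + 1 <= M by exact: ler_norm.
  split=> [x|x y]; first exact: le_trans (bd x) MM.
  by apply: le_trans (li x y) _; rewrite ler_wpM2r.
have box_bound a b t : a <= b -> t \in `[0, T] ->
    `|\int[mu]_(x in `[a, b]) u t x| <= M * (b - a).
  move=> ab; apply: (@ae_bound_everywhere _ _
    (fun t => \int[mu]_(x in `[a, b]) u t x) _ T0 (box_continuous ab)).
  move: good; apply: ae_imp => {}t H tT; have [bd _] := H tT.
  apply: Rintegral_ae_bound => //.
    by apply: continuous_integrable; exact: uc.
  exact: aeW.
(* The last term bounds the error made when a Lipschitz profile is replaced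
   by its value at the left end of each interval; it disappears with e. *)
have box_lip x y e t : 0 <= e -> t \in `[0, T] ->
    `|\int[mu]_(z in `[x, x + e]) u t z - \int[mu]_(z in `[y, y + e]) u t z|
      <= e * M * `|x - y| + 2 * M * e * e.
  move=> e0; have le z : z <= z + e by rewrite lerDl.
  apply: (@ae_bound_everywhere _ _ (fun t => \int[mu]_(z in `[x, x + e]) u t z -
     \int[mu]_(z in `[y, y + e]) u t z)) => //.
    have /subspace_continuousP cx := box_continuous (le x).
    have /subspace_continuousP cy := box_continuous (le y).
    apply/subspace_continuousP => s sT.
    by apply: cvgB; [exact: cx|exact: cy].
  move: good; apply: ae_imp => {}t H tT; have [_ li] := H tT.
  have := Rintegral_lipschitz_avg x li M_ge0 e0.
  have := Rintegral_lipschitz_avg y li M_ge0 e0.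
  have := ler_wpM2r e0 (li x y); rewrite -[X in _ * X <= _](ger0_norm e0) -normrM.
  move: (Rintegral _ _ _) (Rintegral _ _ _) => I J.
  rewrite !ler_norml => /andP[? ?] /andP[? ?] /andP[? ?].
  apply/andP; split; lra.
exists M => // t tT; have ct := uc tT.
have step x y e : 0 < e -> exists2 d, 0 < d <= e &
    `|\int[mu]_(z in `[x, x + d]) u t z - u t x * d| <= e * d /\
    `|\int[mu]_(z in `[y, y + d]) u t z - u t y * d| <= e * d.
  move=> e0; have [r1 r10 H1] := Rintegral_continuous_avg x ct e0.
  have [r2 r20 H2] := Rintegral_continuous_avg y ct e0.
  pose d := Num.min e (Num.min r1 r2).
  have d0 : 0 < d by rewrite !lt_min e0 r10.
  have [d1 [d2 d3]] : d <= e /\ d <= r1 /\ d <= r2.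
    by rewrite /d !ge_min !lexx !orbT.
  exists d; first by rewrite d0 d1.
  by split; [apply: H1|apply: H2]; rewrite ltW//=.
split=> [x|x y].
- apply/ler_addgt0Pr => e e0; have [d /andP[d0 de] [H _]] := step x x e e0.
  have xd : x <= x + d by rewrite lerDl ltW.
  have := box_bound _ _ _ xd tT; rewrite (_ : x + d - x = d); last by ring.
  move: H; move: (Rintegral _ _ _) => I HI HM.
  rewrite -(ler_pM2r d0) -[in leLHS](gtr0_norm d0) -normrM.
  rewrite (_ : u t x * d = I - (I - u t x * d)); last by ring.
  apply: (le_trans (ler_normB _ _)); rewrite mulrDl; exact: lerD.
- apply/ler_addgt0Pr => e e0.
  pose e' := e / (2 * M + 2).
  have M2 : 0 < 2 * M + 2 by lra.
  have e'0 : 0 < e' by rewrite divr_gt0.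
  have ee : e = 2 * M * e' + 2 * e' by rewrite /e'; field; rewrite gt_eqF.
  move: e' e'0 ee => e' e'0 ee.
  have [d /andP[d0 de] [Hx Hy]] := step x y e' e'0.
  have := box_lip x y d t (ltW d0) tT.
  move: Hx Hy; move: (Rintegral _ _ _) (Rintegral _ _ _) => J I HI HJ HIJ.
  rewrite -(ler_pM2r d0) -[in leLHS](gtr0_norm d0) -normrM.
  have -> : (u t x - u t y) * d = (I - J) - (I - u t x * d) + (J - u t y * d).
    by ring.
  apply: (le_trans (ler_normD _ _)).
  apply: (le_trans (lerD (ler_normB _ _) (lexx _))).
  have : 2 * M * d <= 2 * M * e' by rewrite ler_wpM2l// mulr_ge0.
  move=> /(ler_wpM2r (ltW d0)); rewrite ee; lra.
Qed.

Context (M : R) (M0 : 0 <= M).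
Context (uM : forall t x, t \in `[0, T] -> `|u t x| <= M).
Context (uL : forall t, t \in `[0, T] -> Lip M (u t)).

Lemma usqr_continuous t : t \in `[0, T] -> continuous (fun x => u t x ^+ 2).
Proof. by move=> tT x; apply: cvgM; exact: uc. Qed.

Lemma q_bound t : t \in `[0, T] -> {ae mu, forall x, `|q t x| <= 2 * M * M}.
Proof.
move=> tT; have [_ wq] := wux tT.
apply: (weak_derivative_bound (usqr_continuous tT) wq) => x y.
rewrite subr_sqr normrM.
have := uM x tT; have := uM y tT; have := uL tT x y.
have := ler_normD (u t x) (u t y).
have := normr_ge0 (u t x - u t y); have := normr_ge0 (u t x + u t y).
move: `|_ + _| `|_ - _| `|x - y| => A B C A0 B0 AA BC yM xM.
have : B * A <= B * (2 * M) by rewrite ler_wpM2l//; lra.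
have : B * (2 * M) <= M * C * (2 * M) by rewrite ler_wpM2r//; lra.
lra.
Qed.

Lemma q_measurable t : t \in `[0, T] -> measurable_fun setT (q t).
Proof. by move=> tT; have [_ [_ [mq _ _] _]] := wux tT. Qed.

Lemma h_bound t x : t \in `[0, T] -> `|h t x| <= 2 * M * M.
Proof.
by move=> tT; case: (helmholtz_inv_integrable x (q_measurable tT) (q_bound tT)).
Qed.

Lemma h_lipschitz t : t \in `[0, T] -> Lip (14 * M * M) (h t).
Proof.
move=> tT; have := helmholtz_inv_lipschitz (q_measurable tT) (q_bound tT).
by rewrite (_ : 7 * (2 * M * M) = 14 * M * M)//; ring.
Qed.

(** The product u u_x is half the weak derivative of u^2. *)
Lemma ut_flux t : t \in `[0, T] ->
  {ae mu, forall x, ut t x = - (2^-1 * q t x) - 3 / 2 * h t x}.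
Proof.
move=> tT; have [wu wq] := wux tT.
have := weak_derivative_sqr (uc tT) wu wq.
by apply: ae_imp2 (eqn tT) => x E ->; rewrite /h; lra.
Qed.

Lemma ut_bound t : t \in `[0, T] -> {ae mu, forall x, `|ut t x| <= 4 * M * M}.
Proof.
move=> tT; apply: ae_imp2 (ut_flux tT) (q_bound tT) => x -> qx.
have := h_bound x tT; move: qx; rewrite !ler_norml.
by move=> /andP[? ?] /andP[? ?]; apply/andP; split; lra.
Qed.

Lemma box_flux t a b : t \in `[0, T] -> a < b ->
  \int[mu]_(x in `[a, b]) ut t x =
  - ((u t b ^+ 2 - u t a ^+ 2) / 2) - 3 / 2 * \int[mu]_(x in `[a, b]) h t x.
Proof.
move=> tT ab; have [_ wq] := wux tT.
have hc : continuous (h t) by exact: lipschitz_continuous (h_lipschitz tT).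
have ih := continuous_integrable a b hc.
have iq : mu.-integrable `[a, b] (EFin \o q t).
  by apply: integrable_itv; case: wq.
have iut := L2_integrable_itv a b (Cut.1 t tT).
have iZ r f : mu.-integrable `[a, b] (EFin \o f) ->
    mu.-integrable `[a, b] (EFin \o (fun x => r * f x)).
  by move=> jf; exact: (integrableZl _ r jf).
have iq2 := iZ (- 2^-1) _ iq; have ih2 := iZ (3 / 2) _ ih.
have -> : \int[mu]_(x in `[a, b]) ut t x =
    \int[mu]_(x in `[a, b]) (- 2^-1 * q t x - 3 / 2 * h t x).
  congr fine; apply: ae_eq_integral => //.
  - exact: measurable_int iut.
  - exact: (measurable_int _ (integrableB _ iq2 ih2)).
  - move: (ut_flux tT); apply: ae_imp => x -> _; congr EFin.
    by rewrite mulNr.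
rewrite RintegralB//.
have -> : \int[mu]_(x in `[a, b]) (- 2^-1 * q t x) =
  - 2^-1 * \int[mu]_(x in `[a, b]) q t x by apply: RintegralZl.
have -> : \int[mu]_(x in `[a, b]) (3 / 2 * h t x) =
  3 / 2 * \int[mu]_(x in `[a, b]) h t x by apply: RintegralZl.
have /= := weak_derivative_FTC (usqr_continuous tT) wq ab.
move: (Rintegral _ _ _) (Rintegral _ _ _) => A B; lra.
Qed.

(** The right-hand side of the equation is bounded, so integrals of u over an
    interval are Lipschitz in time with a constant proportional to its
    length; divide by the length and let it tend to 0. *)
Lemma u_time_lipschitz s t x : s \in `[0, T] -> t \in `[0, T] ->
  `|u s x - u t x| <= 4 * M * M * `|s - t|.
Proof.
wlog st : s t / s <= t.
  move=> H sT tT; have [/H|/ltW/H] := leP s t; first exact.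
  by rewrite distrC (distrC s); exact.
move=> sT tT; move: (sT) (tT); rewrite !in_itv/= => /andP[s0 _] /andP[_ tT'].
have box a b : a <= b -> `|\int[mu]_(x in `[a, b]) u t x -
    \int[mu]_(x in `[a, b]) u s x| <= 4 * M * M * (b - a) * (t - s).
  move=> ab; have sI r : r \in `]s, t[ -> r \in `[0, T] /\ r \in `]0, T[.
    by rewrite !in_itv/= => /andP[? ?]; split; apply/andP; split; lra.
  apply: (@MVT_bound _ (fun r => \int[mu]_(x in `[a, b]) u r x)
    (fun r => \int[mu]_(x in `[a, b]) ut r x)) => // [r /sI[rT rT']||r /sI[rT _]].
  - exact: slope_cvg_derive rT' (box_slope rT ab).
  - apply: continuous_subspaceW (box_continuous ab).
    by move=> r /=; rewrite !in_itv/= => /andP[? ?]; apply/andP; split; lra.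
  - apply: Rintegral_ae_bound => //; last exact: ut_bound.
    exact: L2_integrable_itv (Cut.1 r rT).
rewrite distrC (distrC s) (ger0_norm (_ : 0 <= t - s)) ?subr_ge0//.
apply/ler_addgt0Pr => e e0.
have M21 : 0 < 2 * M + 1 by rewrite ltr_wpDl // mulr_ge0.
pose d := e / (2 * M + 1); have d0 : 0 < d by rewrite divr_gt0.
have de : 2 * M * d <= e.
  have : (2 * M + 1) * d = e by rewrite /d mulrC divfK// gt_eqF.
  lra.
have xd : x <= x + d by rewrite lerDl ltW.
have := box _ _ xd; rewrite (_ : x + d - x = d); last by ring.
have := Rintegral_lipschitz_avg x (uL sT) M0 (ltW d0).
have := Rintegral_lipschitz_avg x (uL tT) M0 (ltW d0).
move: (Rintegral _ _ _) (Rintegral _ _ _) => J I HI HJ HIJ.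
rewrite -(ler_pM2r d0) -[in leLHS](gtr0_norm d0) -normrM.
have := ler_wpM2r (ltW d0) de.
have -> : (u t x - u s x) * d = (I - J) - (I - u t x * d) + (J - u s x * d).
  by ring.
have := ler_normD (I - J - (I - u t x * d)) (J - u s x * d).
have := ler_normB (I - J) (I - u t x * d).
lra.
Qed.

(** Convergence in L^2 becomes pointwise for functions with a common Lipschitz
    constant, by comparison with averages over an interval of length d. *)
Lemma h_time_continuous t x : t \in `[0, T] ->
  h s x @[s --> within `[0, T] (nbhs t)] --> h t x.
Proof.
move=> tT; have FF : Filter (within `[0, T] (nbhs t)) by exact: within_filter.
have nI : \forall s \near within `[0, T] (nbhs t), s \in `[0, T].
  exact: withinT.
have mh s : s \in `[0, T] -> measurable_fun setT (h s).
  move=> sT; apply: continuous_measurable_fun.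
  exact: lipschitz_continuous (h_lipschitz sT).
have mhst : \forall s \near within `[0, T] (nbhs t),
    measurable_fun setT (h s \- h t).
  by apply: filterS nI => s sT; apply: measurable_funB; exact: mh.
have [N N0 hL] : exists2 N, 0 <= N & forall s, s \in `[0, T] -> Lip N (h s).
  by exists (14 * M * M); [rewrite !mulr_ge0|exact: h_lipschitz].
apply/cvgrPdist_le => e e0.
have N1 : 0 < 2 * N + 1 by rewrite ltr_wpDl // mulr_ge0.
pose d := e / (2 * (2 * N + 1)).
have d0 : 0 < d by rewrite divr_gt0// mulr_gt0.
have dE : 2 * N * d + d = e / 2.
  by rewrite /d; field; rewrite gt_eqF.
have ed : 0 < e / 2 * d by rewrite mulr_gt0// divr_gt0.
have := L2_Rintegral_cvg x (x + d) FF (Ch.2 t tT) mhst.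
move=> /cvgrPdist_le/(_ _ ed); apply: filterS2 nI => s sT.
have ihs := continuous_integrable x (x + d) (lipschitz_continuous (hL _ sT)).
have iht := continuous_integrable x (x + d) (lipschitz_continuous (hL _ tT)).
rewrite sub0r normrN RintegralB//.
have := Rintegral_lipschitz_avg x (hL _ sT) N0 (ltW d0).
have := Rintegral_lipschitz_avg x (hL _ tT) N0 (ltW d0).
move: (Rintegral _ _ _) (Rintegral _ _ _) => J I HI HJ HIJ.
rewrite distrC -(ler_pM2r d0) -[in leLHS](gtr0_norm d0) -normrM.
have -> : (h s x - h t x) * d = (J - I) - (J - h s x * d) + (I - h t x * d).
  by ring.
have := ler_normD (J - I - (J - h s x * d)) (I - h t x * d).
have := ler_normB (J - I) (J - h s x * d).
have : (2 * N * d + d) * d <= e / 2 * d by rewrite dE.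
have : 0 < d * d by rewrite mulr_gt0.
lra.
Qed.

Lemma DP_transport_data : transport_data (M + 14 * M * M) T u h.
Proof.
have MM : 0 <= M * M by rewrite mulr_ge0.
have le4 : 4 * M * M <= M + 14 * M * M by rewrite -!mulrA ler_wpDl// ler_wpM2r// ler_nat.
have le12 : 12 * M * M <= M + 14 * M * M.
  by rewrite -!mulrA ler_wpDl// ler_wpM2r// ler_nat.
have le14 : 14 * M * M <= M + 14 * M * M by rewrite lerDr.
have le1 : M <= M + 14 * M * M by rewrite lerDl !mulr_ge0.
have le K x : 0 <= x -> K <= M + 14 * M * M -> K * x <= (M + 14 * M * M) * x.
  by move=> x0 KC; rewrite ler_wpM2r.
split.
- by rewrite addr_ge0// !mulr_ge0.
- by move=> t x tT; apply: (le_trans (uM x tT)); rewrite lerDl !mulr_ge0.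
- move=> t tT x y; apply: (le_trans (uL tT x y)); exact: le.
- move=> s t x sT tT; apply: (le_trans (u_time_lipschitz x sT tT)).
  by exact: le.
- move=> t tT x y; apply: (le_trans (h_lipschitz tT x y)); exact: le.
- by move=> t x; exact: h_time_continuous.
- move=> t x0 rho x1 x2 x3 x4 tT /andP[r0 r1] h1 h2 h3 h4.
  apply: (le_trans (helmholtz_inv_slope (q_measurable tT) (q_bound tT)
    r1 r0 h1 h2 h3 h4)).
  rewrite (_ : 6 * (2 * M * M) * rho * _ =
    12 * M * M * (rho * (`|x1 - x2| * `|x3 - x4|))); last by ring.
  by rewrite -(mulrA (M + _)); apply: le => //; rewrite !mulr_ge0.
- move=> t a b tT ab; rewrite -(box_flux tT ab); exact: box_slope tT (ltW ab).
Qed.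

End Evolution.

(** * The velocity along a characteristic *)

Section Characteristics.
Context {R : realType}.
Local Notation mu := (@lebesgue_measure R).
Implicit Types (f g : R -> R) (a b c x y s t L e : R).

Lemma Rintegral_split f a b c : continuous f -> c <= a -> a <= b ->
  \int[mu]_(x in `[c, b]) f x - \int[mu]_(x in `[c, a]) f x =
  \int[mu]_(x in `[a, b]) f x.
Proof.
move=> cf ca ab; rewrite Rintegral_itvB//.
- rewrite Rintegral_itv_obnd_cbnd//.
  apply: integrableS (continuous_integrable a b cf) => //.
  exact: subset_itv_oc_cc.
- exact: continuous_integrable.
Qed.

Lemma primitive_step L f c y y' : Lip L f -> 0 <= L -> c <= y -> c <= y' ->
  `|\int[mu]_(x in `[c, y']) f x - \int[mu]_(x in `[c, y]) f x - f y * (y' - y)|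
    <= L * `|y' - y| * `|y' - y|.
Proof.
move=> Lf L0 cy cy'; have cf := lipschitz_continuous Lf.
have [yy'|/ltW y'y] := leP y y'.
  rewrite (Rintegral_split cf cy yy') (ger0_norm (_ : 0 <= y' - y)) ?subr_ge0//.
  apply: Rintegral_near_cst => // x /andP[yx xy'].
  apply: le_trans (Lf x y) _; rewrite ler_wpM2l// ger0_norm ?subr_ge0//.
  by rewrite lerD2r.
rewrite (distrC y') [X in X <= _](_ : _ =
  `|\int[mu]_(x in `[c, y]) f x - \int[mu]_(x in `[c, y']) f x - f y * (y - y')|);
  last first.
  rewrite -[in RHS]normrN; congr `|_|.
  by move: (Rintegral _ _ _) (Rintegral _ _ _) => I J; ring.
rewrite (Rintegral_split cf cy' y'y) (ger0_norm (_ : 0 <= y - y')) ?subr_ge0//.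
apply: Rintegral_near_cst => // x /andP[yx xy'].
apply: le_trans (Lf x y) _; rewrite ler_wpM2l// distrC ger0_norm ?subr_ge0//.
by rewrite lerB.
Qed.

Context (C T : R) (u h : R -> R -> R) (D : transport_data C T u h).

Let C0 : 0 <= C := td_C D.

Let flux t a b : R :=
  - ((u t b ^+ 2 - u t a ^+ 2) / 2) - 3 / 2 * \int[mu]_(x in `[a, b]) h t x.

Lemma near_itv t : t \in `]0, T[ -> \forall s \near t, s \in `]0, T[.
Proof.
by move=> tT; apply: (@open_nbhs_nbhs _ t (`]0, T[%classic : set R)); split.
Qed.

(** The chain rule for an integral of u with a moving end point Y: its two
    ingredients are the balance law on a fixed interval and the joint
    continuity of u. *)
Lemma primitive_chain c Y dY t : t \in `]0, T[ -> c < Y t ->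
  is_derive t 1 Y dY ->
  is_derive t 1 (fun s => \int[mu]_(x in `[c, Y s]) u s x)
    (flux t c (Y t) + u t (Y t) * dY).
Proof.
move=> tT cY dYt; have tT' := itvW tT.
have Yc : {for t, continuous Y}.
  by apply: differentiable_continuous; apply/derivable1_diffP; exact: ex_derive.
apply: is_derive_approx => e e0.
have C2 : 0 < C + 2 by rewrite ltr_wpDl.
pose e1 := e / (C + 2); have e10 : 0 < e1 by rewrite divr_gt0.
have eE : e = e1 + C * e1 + e1.
  by rewrite /e1; field; rewrite gt_eqF.
pose B := `|dY| + 1; have B0 : 0 < B by rewrite ltr_wpDl.
have K0 : 0 < B * (C * B + C) + 1.
  by rewrite ltr_wpDl// mulr_ge0// ?(ltW B0)// addr_ge0// mulr_ge0// ltW.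
have d0 : 0 < e1 / (B * (C * B + C) + 1) by rewrite divr_gt0.
near=> s.
have sT : s \in `[0, T] by apply: itvW; near: s; exact: near_itv.
have cYs : c < Y s by near: s; exact: cvgr_gt Yc _ cY.
have N1 : `|\int[mu]_(x in `[c, Y t]) u s x - \int[mu]_(x in `[c, Y t]) u t x -
    flux t c (Y t) * (s - t)| <= e1 * `|s - t|.
  move: sT; near: s; exact: slope_cvg_approx (td_box D tT' cY) _ e10.
have N2 : `|Y s - Y t - dY * (s - t)| <= e1 * `|s - t|.
  by near: s; exact: is_derive_approxE dYt _ e10.
have N3 : `|Y s - Y t - dY * (s - t)| <= 1 * `|s - t|.
  by near: s; exact: is_derive_approxE dYt _ ltr01.
have N4 : `|s - t| < e1 / (B * (C * B + C) + 1).
  near: s; apply: filterS (nbhsx_ballx t _ d0) => s.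
  by rewrite -ball_normE /= distrC.
have st0 := normr_ge0 (s - t).
have YB : `|Y s - Y t| <= B * `|s - t|.
  have -> : Y s - Y t = (Y s - Y t - dY * (s - t)) + dY * (s - t) by ring.
  apply: (le_trans (ler_normD _ _)); rewrite normrM /B mulrDl addrC lerD//.
have N5 := primitive_step (td_space D sT) C0 (ltW cY) (ltW cYs).
have N6 := td_time D (Y t) sT tT'.
have N7 : `|\int[mu]_(x in `[c, Y s]) u s x - \int[mu]_(x in `[c, Y t]) u s x -
    u t (Y t) * (Y s - Y t)| <= e1 * `|s - t|.
  have -> : \int[mu]_(x in `[c, Y s]) u s x - \int[mu]_(x in `[c, Y t]) u s x -
    u t (Y t) * (Y s - Y t) =
    (\int[mu]_(x in `[c, Y s]) u s x - \int[mu]_(x in `[c, Y t]) u s x -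
    u s (Y t) * (Y s - Y t)) + (u s (Y t) - u t (Y t)) * (Y s - Y t).
    by move: (Rintegral _ _ _) (Rintegral _ _ _) => I J; ring.
  apply: (le_trans (ler_normD _ _)); rewrite normrM.
  apply: (le_trans (lerD N5 (ler_wpM2r (normr_ge0 _) N6))).
  have st1 : B * (C * B + C) * `|s - t| <= e1.
    apply: (@le_trans _ _ ((B * (C * B + C) + 1) * `|s - t|)).
      by rewrite ler_wpM2r// lerDl.
    by rewrite mulrC -ler_pdivlMr// ltW.
  have := ler_wpM2r st0 st1.
  have CY : C * `|Y s - Y t| <= C * (B * `|s - t|) by rewrite ler_wpM2l.
  have := ler_wpM2r (normr_ge0 (Y s - Y t)) CY.
  have CB : 0 <= C * (B * `|s - t|) + C * `|s - t|.
    by rewrite addr_ge0// !mulr_ge0// ltW.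
  have := ler_wpM2l CB YB.
  lra.
have N8 : `|u t (Y t) * (Y s - Y t - dY * (s - t))| <= C * e1 * `|s - t|.
  by rewrite normrM -mulrA ler_pM// (td_bound D).
move: N1 N7 N8; rewrite eE.
move: (flux t c (Y t)) (u t (Y t)) (Rintegral _ _ _) => phi w.
move: (Rintegral _ _ _) (Rintegral _ _ _) => I1 I3 I2 N1 N7 N8.
have -> : I1 - I3 - (phi + w * dY) * (s - t) = (I1 - I2 - w * (Y s - Y t)) +
    w * (Y s - Y t - dY * (s - t)) + (I2 - I3 - phi * (s - t)) by ring.
apply: (le_trans (ler_normD _ _)); rewrite !mulrDl lerD//.
by apply: (le_trans (ler_normD _ _)); rewrite lerD.
Unshelve. all: by end_near. Qed.

Context (X : R -> R).
Context (dX : forall t, t \in `[0, T] -> slope_cvg T X t (u t (X t))).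

Let X_continuous : {within `[0, T], continuous X}.
Proof. by apply: slope_cvg_continuous => t tT; eexists; exact: dX. Qed.

Lemma path_lipschitz s t : s \in `[0, T] -> t \in `[0, T] ->
  `|X s - X t| <= C * `|s - t|.
Proof.
wlog st : s t / s <= t.
  move=> H sT tT; have [/H|/ltW/H] := leP s t; first exact.
  by rewrite distrC (distrC s); exact.
move=> sT tT; move: (sT) (tT); rewrite !in_itv/= => /andP[s0 _] /andP[_ tT'].
rewrite distrC (distrC s) (ger0_norm (_ : 0 <= t - s)) ?subr_ge0//.
have sI r : r \in `]s, t[ -> r \in `]0, T[.
  by rewrite !in_itv/= => /andP[? ?]; apply/andP; split; lra.
apply: (@MVT_bound _ X (fun r => u r (X r))) => // [r /sI rT||r /sI/itvW rT].
- exact: slope_cvg_derive rT (dX (itvW rT)).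
- apply: continuous_subspaceW X_continuous.
  by move=> r /=; rewrite !in_itv/= => /andP[? ?]; apply/andP; split; lra.
- exact: td_bound D _ _ rT.
Qed.

(** The integral of u s over [X s - eps, X s + eps], as a difference of
    primitives.  Their base point lies to the left of the whole moving
    interval for eps <= 1, since X moves by at most C T. *)
Let box eps s : R :=
  \int[mu]_(x in `[X 0 - C * T - 2, X s + eps]) u s x -
  \int[mu]_(x in `[X 0 - C * T - 2, X s - eps]) u s x.

Let base_lt eps s : 0 < T -> 0 < eps <= 1 -> s \in `[0, T] ->
  X 0 - C * T - 2 < X s - eps.
Proof.
move=> T0 /andP[e0 e1] sT.
have zT : 0 \in `[0, T] by rewrite in_itv/= lexx ltW.
have := path_lipschitz sT zT; rewrite subr0.
move: (sT); rewrite in_itv/= => /andP[s0 sT'].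
rewrite (ger0_norm s0) ler_norml => /andP[H _].
have := ler_wpM2l C0 sT'; lra.
Qed.

(** Write p, m and w for u at X + eps, X - eps and X.  The moving ends
    contribute (p - m) w and the flux - (p^2 - m^2) / 2; together these give
    (p - m) (w - (p + m) / 2), which is of order eps^2. *)
Let box_derive eps t : 0 < T -> 0 < eps <= 1 -> t \in `]0, T[ ->
  exists2 dE, is_derive t 1 (box eps) dE &
    `|dE + 3 / 2 * (2 * eps) * h t (X t)| <= (2 * C * C + 3 * C) * eps * eps.
Proof.
move=> T0 e01 tT; have tT' := itvW tT.
have /andP[e0 e1] := e01.
have bl := base_lt T0 e01 tT'.
set c := X 0 - C * T - 2 in bl.
have br : c < X t + eps by apply: lt_trans bl _; lra.
have dXt := slope_cvg_derive tT (dX tT').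
have dYr : is_derive t 1 (fun s => X s + eps) (u t (X t)).
  by rewrite -[u t _]addr0; apply: is_deriveD.
have dYl : is_derive t 1 (fun s => X s - eps) (u t (X t)).
  by rewrite -[u t _]subr0; apply: is_deriveB.
have Dr := @primitive_chain c _ _ t tT br dYr.
have Dl := @primitive_chain c _ _ t tT bl dYl.
exists (flux t c (X t + eps) + u t (X t + eps) * u t (X t) -
        (flux t c (X t - eps) + u t (X t - eps) * u t (X t))).
  exact: is_deriveB.
have hL := td_hspace D tT'.
have bm : c < X t by apply: lt_trans bl _; lra.
have := primitive_step hL C0 (ltW bm) (ltW br).
have := primitive_step hL C0 (ltW bm) (ltW bl).
rewrite (_ : X t + eps - X t = eps); last by ring.
rewrite (_ : X t - eps - X t = - eps); last by ring.
rewrite normrN (gtr0_norm e0) /flux.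
have := td_space D tT' (X t + eps) (X t - eps).
have := td_space D tT' (X t) (X t - eps).
have := td_space D tT' (X t) (X t + eps).
rewrite (_ : X t + eps - (X t - eps) = 2 * eps); last by ring.
rewrite (_ : X t - (X t + eps) = - eps); last by ring.
rewrite (_ : X t - (X t - eps) = eps); last by ring.
rewrite normrN (gtr0_norm e0) normrM (gtr0_norm e0) ger0_norm//.
move: (u t (X t + eps)) (u t (X t - eps)) (u t (X t)) (h t (X t)) (u t c).
move=> p m w hX k; move: (Rintegral _ _ _) (Rintegral _ _ _) (Rintegral _ _ _).
move=> Hp Hc Hm wp wm pm Hme Hpe.
have -> : - ((p ^+ 2 - k ^+ 2) / 2) - 3 / 2 * Hp + p * w -
    (- ((m ^+ 2 - k ^+ 2) / 2) - 3 / 2 * Hm + m * w) + 3 / 2 * (2 * eps) * hX =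
  (p - m) * ((w - p) + (w - m)) / 2
  - 3 / 2 * ((Hp - Hc - hX * eps) - (Hm - Hc - hX * - eps)) by field.
apply: (le_trans (ler_normB _ _)); rewrite !normrM.
rewrite (@ger0_norm _ 3)// (@ger0_norm _ 2^-1) ?invr_ge0//.
have W := le_trans (ler_normD (w - p) (w - m)) (lerD wp wm).
have H := le_trans (ler_normB (Hp - Hc - hX * eps) (Hm - Hc - hX * - eps)) (lerD Hpe Hme).
have PW := ler_pM (normr_ge0 _) (normr_ge0 _) pm W.
lra.
Qed.

Let box_approx eps s : 0 < T -> 0 < eps <= 1 -> s \in `[0, T] ->
  `|box eps s - 2 * eps * u s (X s)| <= 2 * C * eps * eps.
Proof.
move=> T0 e01 sT; have /andP[e0 e1] := e01; rewrite /box.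
have bl := base_lt T0 e01 sT; set c := X 0 - C * T - 2 in bl *.
have bm : c < X s by apply: lt_trans bl _; lra.
have br : c < X s + eps by apply: lt_trans bm _; lra.
have := primitive_step (td_space D sT) C0 (ltW bm) (ltW br).
have := primitive_step (td_space D sT) C0 (ltW bm) (ltW bl).
rewrite (_ : X s + eps - X s = eps); last by ring.
rewrite (_ : X s - eps - X s = - eps); last by ring.
rewrite normrN (gtr0_norm e0); move: (u s (X s)) => w.
move: (Rintegral _ _ _) (Rintegral _ _ _) (Rintegral _ _ _) => Hp Hc Hm H1 H2.
rewrite (_ : Hp - Hm - 2 * eps * w = (Hp - Hc - w * eps) - (Hm - Hc - w * - eps));
  last by ring.
apply: (le_trans (ler_normB _ _)); lra.
Qed.

Lemma MVT_ball f K t r : (forall x, `|x - t| < r -> exists2 d,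
    is_derive x 1 f d & `|d| <= K) ->
  forall s, `|s - t| < r -> `|f s - f t| <= K * `|s - t|.
Proof.
move=> H; have M a b : a <= b -> (forall x, a <= x <= b -> `|x - t| < r) ->
    `|f b - f a| <= K * (b - a).
  move=> ab abr.
  have df x : a <= x <= b -> is_derive x 1 f (derive1 f x) /\ `|derive1 f x| <= K.
    move=> /abr/H[d dx dK]; rewrite derive1E (@derive_val _ _ _ _ _ _ _ dx).
    by split => //; exact: dx.
  apply: (@MVT_bound _ _ (derive1 f)) => // [x||x].
  - by rewrite in_itv/= => /andP[/ltW ax /ltW xb]; case: (df x _) => //; rewrite ax.
  - apply: derivable_within_continuous => x; rewrite in_itv/= => xab.
    by have [dx _] := df x xab; exact: ex_derive.
  - by rewrite in_itv/= => /andP[/ltW ax /ltW xb]; case: (df x _) => //; rewrite ax.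
move=> s sr; have [st|/ltW ts] := leP s t.
  rewrite distrC (distrC s) (ger0_norm (_ : 0 <= t - s)) ?subr_ge0//.
  apply: M => // x /andP[sx xt]; apply: le_lt_trans sr.
  by rewrite distrC (distrC s) !ger0_norm ?subr_ge0// lerB.
rewrite (ger0_norm (_ : 0 <= s - t)) ?subr_ge0//.
apply: M => // x /andP[tx xs]; apply: le_lt_trans sr.
by rewrite !ger0_norm ?subr_ge0// lerB.
Qed.

(** Apply the mean value theorem to the averages over moving intervals of
    half-length eps, whose derivative is - (3/2) h up to O(eps), and let eps
    tend to 0 before s tends to t. *)
Lemma velocity_derive t : 0 < T -> t \in `]0, T[ ->
  is_derive t 1 (fun s => u s (X s)) (- (3 / 2) * h t (X t)).
Proof.
move=> T0 tT; have tT' := itvW tT; apply: is_derive_approx => e e0.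
have e2 : 0 < e / 4 by rewrite divr_gt0.
have htX : h s (X t) @[s --> within `[0, T] (nbhs t)] --> h t (X t).
  exact: td_htime D _ _ tT'.
have nh : \forall r \near t, (r \in `]0, T[) /\ `|h r (X r) - h t (X t)| <= e / 2.
  near=> r.
  have rT : r \in `]0, T[ by near: r; exact: near_itv.
  split=> //; have rT' := itvW rT.
  have A : `|h t (X t) - h r (X t)| <= e / 4.
    move: rT'; near: r.
    by move/cvgrPdist_le: (htX) => /(_ _ e2).
  have B := td_hspace D rT' (X r) (X t).
  have XC := path_lipschitz rT' tT'.
  have rt : `|r - t| < e / 4 / (C * C + 1).
    near: r; have ec2 : 0 < e / 4 / (C * C + 1).
      by rewrite divr_gt0// ltr_wpDl// mulr_ge0.
    apply: filterS (nbhsx_ballx t _ ec2) => r.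
    by rewrite -ball_normE /= distrC.
  have Cr : C * C * `|r - t| <= e / 4.
    apply: (@le_trans _ _ ((C * C + 1) * `|r - t|)).
      by rewrite ler_wpM2r// lerDl.
    by rewrite mulrC -ler_pdivlMr ?ltW// ltr_wpDl// mulr_ge0.
  have := ler_wpM2l C0 XC.
  rewrite distrC in A.
  have -> : h r (X r) - h t (X t) =
    (h r (X r) - h r (X t)) + (h r (X t) - h t (X t)) by ring.
  have := ler_normD (h r (X r) - h r (X t)) (h r (X t) - h t (X t)).
  lra.
have [r /= r0 Hr] := (nbhs_ballP _ _).1 nh.
apply: filterS (nbhsx_ballx t r r0) => s; rewrite -ball_normE /= distrC => sr.
have in_ball x : `|x - t| < r -> (x \in `]0, T[) /\ `|h x (X x) - h t (X t)| <= e / 2.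
  by move=> xr; apply: Hr; rewrite -ball_normE /= distrC.
pose K := 2 * C * C + 3 * C.
have K0 : 0 <= K by rewrite addr_ge0// !mulr_ge0.
set hX := h t (X t) in in_ball *.
(* The first error comes from the variation of h along X between s and t, the
   second from the width of the moving interval. *)
have main eps : 0 < eps <= 1 ->
    `|u s (X s) - u t (X t) - - (3 / 2) * hX * (s - t)| <=
    3 / 4 * e * `|s - t| + eps * (K * `|s - t| / 2 + 2 * C).
  move=> e01; have /andP[ep0 _] := e01.
  have G : `|(box eps s + 3 * eps * hX * s) - (box eps t + 3 * eps * hX * t)| <=
      (K * eps * eps + 3 * eps * (e / 2)) * `|s - t|.
    apply: (@MVT_ball (fun x => box eps x + 3 * eps * hX * x) _ t r) => // x xr.
    have [xT hx] := in_ball x xr.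
    have [dE dEx dEb] := box_derive T0 e01 xT.
    exists (dE + 3 * eps * hX).
      apply: is_deriveD; rewrite -[X in is_derive _ _ _ X]mulr1.
      exact: is_deriveZ.
    rewrite (_ : dE + _ = (dE + 3 / 2 * (2 * eps) * h x (X x)) -
      3 * eps * (h x (X x) - hX)); last by field.
    apply: (le_trans (ler_normB _ _)); apply: lerD => //.
    rewrite normrM ger0_norm; last by rewrite mulr_ge0// ltW.
    by rewrite ler_wpM2l// mulr_ge0// ltW.
  have As := box_approx T0 e01 (itvW (in_ball s sr).1).
  have At := box_approx T0 e01 tT'.
  have p2 : 0 < 2 * eps by rewrite mulr_gt0.
  rewrite -(ler_pM2l p2) -[X in X * `|_| <= _](gtr0_norm p2) -normrM.
  move: G As At; move: (box eps s) (box eps t) (u s (X s)) (u t (X t)) => Es Et us ut'.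
  move=> G As At.
  rewrite (_ : 2 * eps * (us - ut' - - (3 / 2) * hX * (s - t)) =
    ((Es + 3 * eps * hX * s) - (Et + 3 * eps * hX * t)) -
    (Es - 2 * eps * us) + (Et - 2 * eps * ut')); last by field.
  apply: (le_trans (ler_normD _ _)).
  apply: (le_trans (lerD (ler_normB _ _) (lexx _))).
  apply: (le_trans (lerD (lerD G As) At)).
  rewrite (_ : _ + _ + _ = 2 * eps * (3 / 4 * e * `|s - t| +
    eps * (K * `|s - t| / 2 + 2 * C)))//.
  by field.
apply: (@le_trans _ _ (3 / 4 * e * `|s - t|)); last first.
  by rewrite ler_wpM2r// ler_piMl ?ltW//; lra.
apply/ler_addgt0Pr => z z0.
set K1 := K * `|s - t| / 2 + 2 * C in main.
have K10 : 0 <= K1 by rewrite addr_ge0// !mulr_ge0// invr_ge0.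
have K11 : 0 < K1 + 1 by rewrite ltr_wpDl.
apply: (le_trans (main (Num.min 1 (z / (K1 + 1))) _)).
  by rewrite lt_min ltr01 divr_gt0// ge_min lexx.
rewrite lerD2l; apply: (@le_trans _ _ (z / (K1 + 1) * (K1 + 1))).
  apply: ler_pM => //; first by rewrite le_min ler01 ltW// divr_gt0.
    by rewrite ge_min lexx orbT.
  by rewrite lerDl.
by rewrite divfK// gt_eqF.
Unshelve. all: by end_near. Qed.

Lemma velocity_lipschitz s t : s \in `[0, T] -> t \in `[0, T] ->
  `|u s (X s) - u t (X t)| <= (C * C + C) * `|s - t|.
Proof.
move=> sT tT; have -> : u s (X s) - u t (X t) =
  (u s (X s) - u s (X t)) + (u s (X t) - u t (X t)) by ring.
apply: (le_trans (ler_normD _ _)); rewrite mulrDl lerD//.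
  apply: (le_trans (td_space D sT _ _)).
  by rewrite -mulrA ler_wpM2l//; exact: path_lipschitz.
exact: (td_time D).
Qed.

End Characteristics.

(** * Strict differentiability *)

Section StrictSlopes.
Context {R : realType}.
Implicit Types (f p : R -> R) (A : set R) (a b x y s t r e K T : R).

Definition slope f x y := (f x - f y) / (x - y).

(** Strict differentiability at x0, stated as a Cauchy condition so that the
    value of the derivative need not be known beforehand. *)
Definition strict_slopes f x0 := forall e, 0 < e -> exists2 r, 0 < r &
  forall x1 x2 x3 x4,
    `|x1 - x0| < r -> `|x2 - x0| < r -> `|x3 - x0| < r -> `|x4 - x0| < r ->
    x1 != x2 -> x3 != x4 -> `|slope f x1 x2 - slope f x3 x4| <= e.

Lemma slopeC f x y : slope f x y = slope f y x.
Proof. by rewrite /slope -opprB -(opprB y x) invrN mulrNN. Qed.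

Lemma C1_on_strict_slopes A f x0 : open A -> C1_on A f -> A x0 ->
  strict_slopes f x0.
Proof.
move=> oA [df cf'] Ax0 e e0.
have e2 : 0 < e / 2 by rewrite divr_gt0.
have nA : \forall x \near x0, A x by exact: open_nbhs_nbhs.
have cx0 : derive1 f @ x0 --> derive1 f x0.
  by move: cf'; rewrite continuous_open_subspace// => /(_ x0); apply; rewrite inE.
have nf : \forall x \near x0, A x /\ `|derive1 f x0 - derive1 f x| <= e / 2.
  by move/cvgrPdist_le : cx0 => /(_ _ e2); apply: filterS2 nA => x Ax fx.
have [r /= r0 Hr] := (nbhs_ballP _ _).1 nf.
exists r => //.
(* By the mean value theorem a quotient is a value of the derivative. *)
have sl x y : `|x - x0| < r -> `|y - x0| < r -> x != y ->
    `|derive1 f x0 - slope f x y| <= e / 2.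
  wlog xy : x y / x < y.
    move=> H hx hy; rewrite neq_lt => /orP[xy|yx].
      by apply: H => //; rewrite lt_eqF.
    by rewrite slopeC; apply: H => //; rewrite lt_eqF.
  move=> hx hy _.
  have inb z : x <= z <= y -> A z /\ `|derive1 f x0 - derive1 f z| <= e / 2.
    move=> /andP[xz zy]; apply: Hr; rewrite -ball_normE /= ltr_norml.
    by move: hx hy; rewrite !ltr_norml => /andP[? ?] /andP[? ?]; apply/andP; split; lra.
  have dz z : z \in `]x, y[ -> is_derive z 1 f (derive1 f z).
    rewrite in_itv/= => /andP[/ltW xz /ltW zy].
    have [Az _] := inb z ltac:(by rewrite xz).
    by rewrite derive1E; apply/derivableP; exact: df.
  have cz : {within `[x, y], continuous f}.
    apply: derivable_within_continuous => z; rewrite in_itv/= => /inb[Az _].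
    exact: df.
  have [z] := MVT xy dz cz; rewrite in_itv/= => /andP[/ltW xz /ltW zy] E.
  have -> : slope f x y = derive1 f z.
    by rewrite slopeC /slope E mulfK// subr_eq0 gt_eqF.
  by case: (inb z _) => //; rewrite xz.
move=> x1 x2 x3 x4 h1 h2 h3 h4 n12 n34.
have := sl _ _ h1 h2 n12; have := sl _ _ h3 h4 n34.
rewrite (_ : slope f x1 x2 - slope f x3 x4 = (derive1 f x0 - slope f x3 x4) -
  (derive1 f x0 - slope f x1 x2)); last by ring.
have := ler_normB (derive1 f x0 - slope f x3 x4) (derive1 f x0 - slope f x1 x2).
lra.
Qed.

Lemma strict_slopes_derivable f x0 : strict_slopes f x0 -> derivable f x0 1.
Proof.
move=> H; apply: cauchy_cvg; apply: cauchy_exP => e e0.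
have e2 : 0 < e / 2 by rewrite divr_gt0.
have [r r0 Hr] := H _ e2.
have r2 : 0 < r / 2 by rewrite divr_gt0.
have rr : r / 2 < r by rewrite ltr_pdivrMr// ltr_pMr// ltr1n.
exists (slope f (x0 + r / 2) x0).
have E k : k^-1 *: (f (k *: 1 + x0) - f x0) = slope f (x0 + k) x0.
  rewrite /slope /GRing.scale /= mulr1 (addrC k) mulrC.
  by rewrite (_ : x0 + k - x0 = k)//; ring.
have n0 : \forall k \near (0 : R)^', `|k| < r /\ k != 0.
  near=> k; split; last by near: k; exact: nbhs_dnbhs_neq.
  by near: k; apply: dnbhs0_lt.
apply: filterS n0 => k [kr k0].
rewrite -ball_normE /= E; apply: (@le_lt_trans _ _ (e / 2)).
  apply: Hr; rewrite ?subrr ?normr0//.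
  - by rewrite (_ : x0 + r / 2 - x0 = r / 2) ?(gtr0_norm r2)//; ring.
  - by rewrite (_ : x0 + k - x0 = k)//; ring.
  - by rewrite -subr_eq0 (_ : x0 + r / 2 - x0 = r / 2) ?gt_eqF//; ring.
  - by rewrite -subr_eq0 (_ : x0 + k - x0 = k)//; ring.
by rewrite ltr_pdivrMr// ltr_pMr// ltr1n.
Unshelve. all: by end_near. Qed.

Lemma derive1_slope f x e r : derivable f x 1 -> 0 < e -> 0 < r ->
  exists2 y, `|y - x| < r /\ y != x & `|derive1 f x - slope f y x| <= e.
Proof.
move=> df e0 r0.
have d1 : is_derive x 1 f (derive1 f x) by rewrite derive1E; exact/derivableP.
have [s /= s0 Hs] := (nbhs_ballP _ _).1 (is_derive_approxE d1 e0).
pose d := Num.min r s / 2.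
have m0 : 0 < Num.min r s by rewrite lt_min r0.
have d0 : 0 < d by rewrite divr_gt0.
have dm : d < Num.min r s by rewrite ltr_pdivrMr// ltr_pMr// ltr1n.
move: dm; rewrite lt_min => /andP[dr ds].
have E : x + d - x = d by ring.
exists (x + d); first by rewrite E (gtr0_norm d0) -subr_eq0 E gt_eqF.
have : `|f (x + d) - f x - derive1 f x * (x + d - x)| <= e * `|x + d - x|.
  by apply: Hs; rewrite -ball_normE /= distrC E gtr0_norm.
rewrite /slope !E (gtr0_norm d0) => H.
rewrite -(ler_pM2r d0) -[X in `|_| * X](gtr0_norm d0) -normrM.
by rewrite mulrBl divfK ?gt_eqF// distrC.
Qed.

(** Strict differentiability at each point makes the derivative continuous: the
    quotients near x0 are mutually close, hence so are their limits. *)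
Lemma strict_slopes_C1_on A f : (forall x, A x -> strict_slopes f x) ->
  C1_on A f.
Proof.
move=> H; have df x : A x -> derivable f x 1.
  by move=> /H; exact: strict_slopes_derivable.
split => //; apply/subspace_continuousP => x0 Ax0; apply/cvgrPdist_le => e e0.
have e3 : 0 < e / 3 by rewrite divr_gt0.
have [r r0 Hr] := H _ Ax0 _ e3.
have r2 : 0 < r / 2 by rewrite divr_gt0.
have rr : r / 2 < r by rewrite ltr_pdivrMr// ltr_pMr// ltr1n.
have [y0 [y0r y0x] Hy0] := derive1_slope (df _ Ax0) e3 r0.
suff : \forall x \near x0, A x -> `|derive1 f x0 - derive1 f x| <= e by [].
apply: filterS (nbhsx_ballx x0 _ r2) => x; rewrite -ball_normE /= => xr Ax.
rewrite distrC in xr.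
have [y [yr yx] Hy] := derive1_slope (df _ Ax) e3 r2.
have yr0 : `|y - x0| < r.
  rewrite (_ : y - x0 = (y - x) + (x - x0)); last by ring.
  by apply: (le_lt_trans (ler_normD _ _)); lra.
have x0r : `|x0 - x0| < r by rewrite subrr normr0.
have := Hr _ _ _ _ y0r x0r yr0 (lt_trans xr rr) y0x yx.
rewrite (_ : derive1 f x0 - derive1 f x = (derive1 f x0 - slope f y0 x0) +
  (slope f y0 x0 - slope f y x) - (derive1 f x - slope f y x)); last by ring.
have := ler_normB (derive1 f x0 - slope f y0 x0 + (slope f y0 x0 - slope f y x))
  (derive1 f x - slope f y x).
have := ler_normD (derive1 f x0 - slope f y0 x0) (slope f y0 x0 - slope f y x).
lra.
Qed.

End StrictSlopes.

(** * Difference quotients along the flow *)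

Section FlowRegularity.
Context {R : realType}.
Implicit Types (f p : R -> R) (A : set R) (a b x y s t r e : R).

(** The Gronwall inequality: p t times exp (- b t) is nonincreasing.  Since p
    may be negative, it also yields lower bounds, applied to - p. *)
Lemma exp_comparison T p dp b :
  (forall t, t \in `]0, T[ -> is_derive t 1 p (dp t)) ->
  (forall t, t \in `]0, T[ -> dp t <= b * p t) ->
  {within `[0, T], continuous p} ->
  forall t, t \in `[0, T] -> p t <= p 0 * expR (b * t).
Proof.
move=> dpp dpb cp t tT.
pose g s := p s * expR (- b * s).
have de s : is_derive s 1 (fun s => expR (- b * s)) (- b * expR (- b * s)).
  apply: is_derive_eq.
  by rewrite /GRing.scale /=; ring.
have dg s : s \in `]0, T[ ->
    is_derive s 1 g ((dp s - b * p s) * expR (- b * s)).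
  move=> /dpp dps; have ds := de s.
  apply: (@is_derive_eq _ _ _ _ _ _ _ _ (is_deriveM dps ds)).
  by rewrite /GRing.scale /=; ring.
have cg : {within `[0, T], continuous g}.
  move/subspace_continuousP : cp => cp; apply/subspace_continuousP => s sT.
  apply: cvgM; first exact: cp.
  have cs : {for s, continuous (fun s => expR (- b * s))}.
    apply: differentiable_continuous; apply/derivable1_diffP.
    exact: (@ex_derive _ _ _ _ _ _ _ (de s)).
  exact: cvg_within_filter cs.
have : g t <= g 0.
  move: (tT); rewrite in_itv/= => /andP[t0 tT'].
  apply: (@ler0_derive1_nincr _ g 0 T) => // s sT.
  - exact: (@ex_derive _ _ _ _ _ _ _ (dg s sT)).
  - rewrite derive1E (@derive_val _ _ _ _ _ _ _ (dg s sT)).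
    by rewrite mulr_le0_ge0 ?expR_ge0// subr_le0 dpb.
rewrite /g mulr0 expR0 mulr1 mulNr expRN => H.
by rewrite -ler_pdivrMr ?expR_gt0.
Qed.

Context (C T : R) (u h : R -> R -> R) (D : transport_data C T u h).
Context (T0 : 0 < T) (Phi : R -> R -> R).
Context (Phi0 : forall x, Phi 0 x = x).
Context (dPhi : forall x t, t \in `[0, T] -> slope_cvg T (Phi ^~ x) t (u t (Phi t x))).

Let C0 : 0 <= C := td_C D.

Lemma flow_derive x t : t \in `]0, T[ ->
  is_derive t 1 (Phi ^~ x) (u t (Phi t x)).
Proof.
move=> tT; exact: (@slope_cvg_derive _ T (Phi ^~ x) t _ tT (dPhi (itvW tT))).
Qed.

Lemma flow_continuous x : {within `[0, T], continuous (Phi ^~ x)}.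
Proof. by apply: slope_cvg_continuous => t tT; eexists; exact: dPhi. Qed.

Let gap_derive y1 y2 t : t \in `]0, T[ ->
  is_derive t 1 (fun s => (Phi s y1 - Phi s y2) ^+ 2)
    (2 * (Phi t y1 - Phi t y2) * (u t (Phi t y1) - u t (Phi t y2))).
Proof.
move=> tT; pose gap s := Phi s y1 - Phi s y2.
have dB : is_derive t 1 gap (u t (Phi t y1) - u t (Phi t y2)).
  exact: is_deriveB (flow_derive y1 tT) (flow_derive y2 tT).
have -> : (fun s => (Phi s y1 - Phi s y2) ^+ 2) = gap * gap.
  by apply/funext => s; rewrite expr2.
apply: (@is_derive_eq _ _ _ _ _ _ _ _ (is_deriveM dB dB)).
by rewrite /GRing.scale /= /gap; ring.
Qed.

Let gap_continuous y1 y2 :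
  {within `[0, T], continuous (fun s => Phi s y1 - Phi s y2)}.
Proof.
have /subspace_continuousP c1 := @flow_continuous y1.
have /subspace_continuousP c2 := @flow_continuous y2.
by apply/subspace_continuousP => s sT; apply: cvgB; [exact: c1|exact: c2].
Qed.

Let gap2_continuous y1 y2 :
  {within `[0, T], continuous (fun s => (Phi s y1 - Phi s y2) ^+ 2)}.
Proof.
have /subspace_continuousP c := @gap_continuous y1 y2.
by apply/subspace_continuousP => s sT; apply: cvgM; exact: c.
Qed.

Let gap_rate y1 y2 t : t \in `[0, T] ->
  `|2 * (Phi t y1 - Phi t y2) * (u t (Phi t y1) - u t (Phi t y2))| <=
  2 * C * (Phi t y1 - Phi t y2) ^+ 2.
Proof.
move=> tT; rewrite !normrM ger0_norm// -(real_normK (num_real (_ - _))) expr2.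
rewrite -!mulrA ler_wpM2l// mulrCA ler_wpM2l//; exact: (td_space D).
Qed.

Lemma flow_lipschitz t : t \in `[0, T] -> Lip (expR (C * T)) (Phi t).
Proof.
move=> tT y1 y2.
have := @exp_comparison T (fun s => (Phi s y1 - Phi s y2) ^+ 2) _ (2 * C)
  (fun s sT => gap_derive y1 y2 sT) _ (@gap2_continuous y1 y2) t tT.
rewrite !Phi0 => H.
have {}H : (Phi t y1 - Phi t y2) ^+ 2 <= (y1 - y2) ^+ 2 * expR (2 * C * t).
  apply: H => s sT; apply: (le_trans (ler_norm _)).
  exact: gap_rate (itvW sT).
rewrite -(@ler_pXn2r _ 2)// ?nnegrE ?mulr_ge0 ?expR_ge0//.
rewrite exprMn !real_normK ?num_real// mulrC.
apply: (le_trans H); rewrite ler_wpM2l ?sqr_ge0//.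
rewrite expr2 -expRD ler_expR.
move: tT; rewrite in_itv/= => /andP[t0 tT]; have := ler_wpM2l C0 tT; lra.
Qed.

(** Two characteristics cannot meet: the square of their gap decreases at most
    exponentially. *)
Lemma flow_injective y1 y2 t : t \in `[0, T] -> y1 != y2 -> Phi t y1 != Phi t y2.
Proof.
move=> tT y12; apply/eqP => E.
have := @exp_comparison T (fun s => - (Phi s y1 - Phi s y2) ^+ 2) _ (- (2 * C))
  (fun s sT => is_deriveN (gap_derive y1 y2 sT)) _ _ t tT.
rewrite !Phi0 E subrr expr0n/= oppr0 => H.
have : 0 <= - (y1 - y2) ^+ 2 * expR (- (2 * C) * t).
  apply: H.
  - move=> s sT; rewrite mulrNN lerNl.
    by have := gap_rate y1 y2 (itvW sT); rewrite ler_norml => /andP[].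
  - have /subspace_continuousP c := @gap2_continuous y1 y2.
    by apply/subspace_continuousP => s sT; apply: cvgN; exact: c.
rewrite mulNr oppr_ge0 leNgt mulr_gt0 ?expR_gt0//.
by rewrite lt_neqAle sqr_ge0 andbT eq_sym sqrf_eq0 subr_eq0.
Qed.

Lemma flow_increasing y1 y2 t : t \in `[0, T] -> y1 < y2 -> Phi t y1 < Phi t y2.
Proof.
move=> tT y12; rewrite -subr_gt0 ltNge; apply/negP => le0.
move: (tT); rewrite in_itv/= => /andP[t0 tT'].
have c : {within `[0, t], continuous (fun s => Phi s y2 - Phi s y1)}.
  apply: continuous_subspaceW (@gap_continuous y2 y1) => s /=.
  by rewrite !in_itv/= => /andP[-> /le_trans]; apply.
have [|s st /eqP] := @IVT _ (fun s => Phi s y2 - Phi s y1) 0 t 0 t0 c.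
  by rewrite !Phi0 ge_min le0 orbT/= le_max subr_ge0 ltW.
rewrite subr_eq0; apply/negP; apply: flow_injective; last by rewrite gt_eqF.
by move: st; rewrite !in_itv/= => /andP[-> /le_trans]; apply.
Qed.

Let V_derive y t : t \in `]0, T[ ->
  is_derive t 1 (fun s => u s (Phi s y)) (- (3 / 2) * h t (Phi t y)).
Proof.
by move=> tT; apply: (velocity_derive D (X := Phi ^~ y)) => // s; exact: dPhi.
Qed.

Let V_continuous y : {within `[0, T], continuous (fun s => u s (Phi s y))}.
Proof.
have K0 : 0 <= C * C + C by rewrite addr_ge0// mulr_ge0.
have K1 : 0 < C * C + C + 1 by rewrite ltr_wpDl.
apply/subspace_continuousP => t tT; apply/cvgrPdist_le => e e0.
have d0 : 0 < e / (C * C + C + 1) by rewrite divr_gt0.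
suff : \forall s \near t, s \in `[0, T] ->
  `|u t (Phi t y) - u s (Phi s y)| <= e by [].
apply: filterS (nbhsx_ballx t _ d0) => s; rewrite -ball_normE /= => ts sT.
have := @velocity_lipschitz _ _ _ _ _ D (Phi ^~ y) (fun r => @dPhi y r) t s tT sT.
move=> /le_trans; apply; apply: (@le_trans _ _ ((C * C + C + 1) * `|t - s|)).
  by rewrite ler_wpM2r// lerDl.
by rewrite mulrC -ler_pdivlMr// ltW.
Qed.

Let rate t y1 y2 := slope (u t) (Phi t y1) (Phi t y2).

(** The difference quotient of u is the ratio of the gap in velocity to the gap
    in position, and the former is the derivative of the latter: this is
    where the quadratic term comes from. *)
Lemma slope_riccati y1 y2 t : y1 != y2 -> t \in `]0, T[ ->
  is_derive t 1 (fun s => slope (u s) (Phi s y1) (Phi s y2))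
    (- (3 / 2) * slope (h t) (Phi t y1) (Phi t y2)
     - slope (u t) (Phi t y1) (Phi t y2) ^+ 2).
Proof.
move=> y12 tT; pose gap s := Phi s y1 - Phi s y2.
pose dif s := u s (Phi s y1) - u s (Phi s y2).
have gap0 : gap t != 0 by rewrite subr_eq0 flow_injective// itvW.
have dg : is_derive t 1 gap (u t (Phi t y1) - u t (Phi t y2)).
  exact: is_deriveB (flow_derive y1 tT) (flow_derive y2 tT).
have dd : is_derive t 1 dif
    (- (3 / 2) * h t (Phi t y1) - - (3 / 2) * h t (Phi t y2)).
  exact: is_deriveB (V_derive y1 tT) (V_derive y2 tT).
have -> : (fun s => slope (u s) (Phi s y1) (Phi s y2)) =
  dif * (fun s => (gap s)^-1) by apply/funext.
apply: (@is_derive_eq _ _ _ _ _ _ _ _ (is_deriveM dd (is_deriveV gap0 dg))).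
rewrite /GRing.scale /= /slope -/(gap t) -/(dif t).
by field.
Qed.

Let rate_continuous y1 y2 : y1 != y2 ->
  {within `[0, T], continuous (fun s => rate s y1 y2)}.
Proof.
move=> y12; have /subspace_continuousP c1 := @V_continuous y1.
have /subspace_continuousP c2 := @V_continuous y2.
have /subspace_continuousP cg := @gap_continuous y1 y2.
apply/subspace_continuousP => s sT; apply: cvgM.
  by apply: cvgB; [exact: c1|exact: c2].
by apply: cvgV; [rewrite subr_eq0 flow_injective|exact: cg].
Qed.

Let rate_bound y1 y2 t : y1 != y2 -> t \in `[0, T] -> `|rate t y1 y2| <= C.
Proof.
move=> y12 tT; rewrite /rate /slope normrM normfV.
rewrite ler_pdivrMr ?normr_gt0 ?subr_eq0 ?flow_injective//.
exact: (td_space D).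
Qed.

Let slope_h_close t x0 rho x1 x2 x3 x4 : t \in `[0, T] ->
  0 <= rho <= 2^-1 -> `|x1 - x0| <= rho -> `|x2 - x0| <= rho ->
  `|x3 - x0| <= rho -> `|x4 - x0| <= rho -> x1 != x2 -> x3 != x4 ->
  `|slope (h t) x1 x2 - slope (h t) x3 x4| <= C * rho.
Proof.
move=> tT r1 h1 h2 h3 h4 n12 n34.
have := td_hslope D tT r1 h1 h2 h3 h4.
have a : x1 - x2 != 0 by rewrite subr_eq0.
have b : x3 - x4 != 0 by rewrite subr_eq0.
rewrite -normrM => H; rewrite -(@ler_pM2r _ `|(x1 - x2) * (x3 - x4)|); last first.
  by rewrite normr_gt0 mulf_neq0.
rewrite -normrM; apply: le_trans H.
rewrite (_ : (slope (h t) x1 x2 - slope (h t) x3 x4) * _ =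
  (h t x1 - h t x2) * (x3 - x4) - (h t x3 - h t x4) * (x1 - x2))//.
by rewrite /slope; field; rewrite a b.
Qed.

(** The difference d of the two quotients solves d' = - (sum of the quotients) d
    + source with |source| <= k, so that (d^2)' <= 4 C d^2 + 2 k |d|, which is
    at most (4 C + 1) (d^2 + k^2). *)
Lemma rate_gronwall y0 r k y1 y2 y3 y4 t : 0 <= r -> expR (C * T) * r <= 2^-1 ->
  2 * C * (expR (C * T) * r) <= k ->
  `|y1 - y0| <= r -> `|y2 - y0| <= r -> `|y3 - y0| <= r -> `|y4 - y0| <= r ->
  y1 != y2 -> y3 != y4 -> t \in `[0, T] ->
  (rate t y1 y2 - rate t y3 y4) ^+ 2 + k ^+ 2 <=
  ((rate 0 y1 y2 - rate 0 y3 y4) ^+ 2 + k ^+ 2) * expR ((4 * C + 1) * t).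
Proof.
move=> r0 r2 rk h1 h2 h3 h4 n12 n34 tT.
have e0 := expR_ge0 (C * T).
have rho0 : 0 <= expR (C * T) * r by rewrite mulr_ge0.
have k0 : 0 <= k by apply: le_trans rk; rewrite !mulr_ge0.
pose dif s := rate s y1 y2 - rate s y3 y4.
pose ddif s := (- (3 / 2) * slope (h s) (Phi s y1) (Phi s y2) - rate s y1 y2 ^+ 2)
  - (- (3 / 2) * slope (h s) (Phi s y3) (Phi s y4) - rate s y3 y4 ^+ 2).
have dd s : s \in `]0, T[ -> is_derive s 1 dif (ddif s).
  by move=> sT; exact: is_deriveB (slope_riccati n12 sT) (slope_riccati n34 sT).
apply: (@exp_comparison T (fun s => dif s ^+ 2 + k ^+ 2)
  (fun s => 2 * dif s * ddif s)) => // [s sT|s sT|].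
- have -> : (fun s => dif s ^+ 2 + k ^+ 2) = dif * dif + cst (k ^+ 2).
    by apply/funext => z; rewrite expr2.
  have dM := is_deriveM (dd s sT) (dd s sT).
  apply: (@is_derive_eq _ _ _ _ _ _ _ _ (is_deriveD dM (is_derive_cst _ _ _))).
  by rewrite /GRing.scale /=; ring.
- have sT' := itvW sT.
  have near y : `|y - y0| <= r -> `|Phi s y - Phi s y0| <= expR (C * T) * r.
    move=> yr; apply: (le_trans (flow_lipschitz sT' y y0)).
    by rewrite ler_wpM2l.
  have rr : 0 <= expR (C * T) * r <= 2^-1 by rewrite rho0.
  have m12 := flow_injective sT' n12; have m34 := flow_injective sT' n34.
  have Q := slope_h_close sT' rr (near _ h1) (near _ h2) (near _ h3) (near _ h4) m12 m34.
  have b1 := rate_bound n12 sT'; have b2 := rate_bound n34 sT'.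
  have dE : ddif s = - (3 / 2) * (slope (h s) (Phi s y1) (Phi s y2) -
      slope (h s) (Phi s y3) (Phi s y4)) - (rate s y1 y2 + rate s y3 y4) * dif s.
    by rewrite /ddif /dif; ring.
  have db : `|ddif s| <= k + 2 * C * `|dif s|.
    rewrite dE; apply: (le_trans (ler_normB _ _)); rewrite !normrM normrN.
    apply: lerD.
      rewrite (@ger0_norm _ (3 / 2)) ?divr_ge0//.
      apply: (le_trans (ler_wpM2l _ Q)); first by rewrite divr_ge0.
      have : 0 <= C * (expR (C * T) * r) by rewrite mulr_ge0.
      move=> ?; apply: le_trans rk; rewrite -!mulrA; lra.
    apply: ler_wpM2r => //; apply: (le_trans (ler_normD _ _)); lra.
  apply: (le_trans (ler_norm _)); rewrite !normrM ger0_norm//.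
  have dn := normr_ge0 (dif s).
  have := ler_wpM2l dn db; have := sqr_ge0 (`|dif s| - k).
  rewrite -(real_normK (num_real (dif s))).
  have : 0 <= 4 * C * k ^+ 2 by rewrite mulr_ge0 ?sqr_ge0// mulr_ge0.
  move: `|dif s| `|ddif s| dn => z w z0; lra.
- have /subspace_continuousP c1 := rate_continuous n12.
  have /subspace_continuousP c2 := rate_continuous n34.
  apply/subspace_continuousP => s sT; apply: cvgD; last exact: cvg_cst.
  by apply: cvgM; (apply: cvgB; [exact: c1|exact: c2]).
Qed.

(** Every point close to Phi t y0 is Phi t y with y close to y0, because Phi t
    is continuous and increasing; the estimate for quotients along
    characteristics then applies to arbitrary pairs of points. *)
Lemma strict_slopes_transport y0 t : strict_slopes (u 0) y0 ->
  t \in `[0, T] -> strict_slopes (u t) (Phi t y0).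
Proof.
move=> S tT e e0.
set W := expR ((4 * C + 1) * T).
have C41 : 0 <= 4 * C + 1 by rewrite addr_ge0// mulr_ge0.
have W1 : 1 <= W by rewrite -expR0 ler_expR mulr_ge0// ltW.
have W0 : 0 < W by apply: lt_le_trans W1.
(* Chosen so that twice its square, amplified by the Gronwall factor W, is at
   most the square of e. *)
pose e1 := e / (2 * W); have e10 : 0 < e1 by rewrite divr_gt0// mulr_gt0.
have e1E : e1 * (2 * W) = e by rewrite divfK// gt_eqF// mulr_gt0.
clearbody e1; have [r1 r10 H1] := S e1 e10.
set B := expR (C * T); have B0 : 0 < B by exact: expR_gt0.
have K0 : 0 < 2 * C * B + 1 by rewrite ltr_wpDl// !mulr_ge0// ltW.
(* The three conditions: the initial quotients are e1-close, the images stay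
   within 1/2 of Phi s y0, and the source is at most e1. *)
pose r := Num.min (r1 / 2) (Num.min (2^-1 / B) (e1 / (2 * C * B + 1))).
have r0 : 0 < r by rewrite !lt_min; apply/and3P; split; apply: divr_gt0.
have [ra [rb rc]] : r <= r1 / 2 /\ r <= 2^-1 / B /\ r <= e1 / (2 * C * B + 1).
  by rewrite /r !ge_min !lexx !orbT.
have Br : B * r <= 2^-1 by rewrite mulrC -ler_pdivlMr.
have kr : 2 * C * (B * r) <= e1.
  apply: (@le_trans _ _ ((2 * C * B + 1) * r)).
    by rewrite mulrA ler_wpM2r ?ltW// ltrDl.
  by rewrite mulrC -ler_pdivlMr.
have lo : Phi t (y0 - r) < Phi t y0 by apply: flow_increasing => //; rewrite ltrBlDr ltrDl.
have hi : Phi t y0 < Phi t (y0 + r) by apply: flow_increasing => //; rewrite ltrDl.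
exists (Num.min (Phi t y0 - Phi t (y0 - r)) (Phi t (y0 + r) - Phi t y0)).
  by rewrite lt_min !subr_gt0 lo.
have cPhi : continuous (Phi t) by exact: lipschitz_continuous (flow_lipschitz tT).
have pre x : `|x - Phi t y0| < Num.min (Phi t y0 - Phi t (y0 - r))
    (Phi t (y0 + r) - Phi t y0) -> exists2 y, `|y - y0| <= r & Phi t y = x.
  rewrite lt_min !ltr_norml => /andP[/andP[a _] /andP[_ b]].
  have le : y0 - r <= y0 + r by lra.
  have [|y yr <-] := @IVT _ (Phi t) _ _ x le (continuous_subspaceT cPhi).
    by rewrite ge_min le_max; apply/andP; split; apply/orP; [left|right]; lra.
  exists y => //; rewrite ler_norml; move: yr; rewrite in_itv/= => /andP[? ?].
  by apply/andP; split; lra.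
move=> x1 x2 x3 x4 /pre[y1 h1 <-] /pre[y2 h2 <-] /pre[y3 h3 <-] /pre[y4 h4 <-].
move=> m12 m34.
have n12 : y1 != y2 by apply: contraNneq m12 => ->.
have n34 : y3 != y4 by apply: contraNneq m34 => ->.
have lt1 y : `|y - y0| <= r -> `|y - y0| < r1.
  by move=> yr; apply: (le_lt_trans yr); lra.
have := rate_gronwall (ltW r0) Br kr h1 h2 h3 h4 n12 n34 tT.
have := H1 _ _ _ _ (lt1 _ h1) (lt1 _ h2) (lt1 _ h3) (lt1 _ h4) n12 n34.
rewrite /= /rate !Phi0 -/B.
set d0 := slope (u 0) y1 y2 - _; set d := slope (u t) _ _ - _ => d0e G.
have tW : expR ((4 * C + 1) * t) <= W.
  rewrite ler_expR ler_wpM2l//.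
  by move: tT; rewrite in_itv/= => /andP[].
rewrite -(@ler_pXn2r _ 2)// ?nnegrE ?(ltW e0)// real_normK ?num_real//.
have d02 : d0 ^+ 2 <= e1 ^+ 2.
  by rewrite -(real_normK (num_real d0)) ler_pXn2r// nnegrE// ltW.
have s0 : 0 <= d0 ^+ 2 + e1 ^+ 2 by rewrite addr_ge0// sqr_ge0.
have := ler_wpM2l s0 tW.
have : (d0 ^+ 2 + e1 ^+ 2) * W <= (e1 ^+ 2 + e1 ^+ 2) * W.
  by rewrite ler_wpM2r ?(ltW W0)// lerD.
have : (e1 ^+ 2 + e1 ^+ 2) * W <= e ^+ 2.
  have -> : (e1 ^+ 2 + e1 ^+ 2) * W = e1 ^+ 2 * (2 * W) by ring.
  rewrite -e1E exprMn ler_wpM2l ?sqr_ge0//; nra.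
have := sqr_ge0 e1; lra.
Qed.

End FlowRegularity.

Unset Implicit Arguments.
Set Strict Implicit.

Theorem theorem1p9 (R : realType) (delta T : R) (u0 : R -> R)
    (Omega : set R) (u Phi : R -> R -> R)
    (delta_gt0 : 0 < delta) (T_gt0 : 0 < T)
    (u0_cont : continuous u0)
    (u0_Hs : Hs (1 + delta) u0) (u0_W1oo : W1oo u0)
    (Omega_open : open Omega) (u0_C1 : C1_on Omega u0)
    (u_sol : DP_strong_solution delta T u0 u)
    (Phi_flow : is_flow T u Phi) :
  forall t, t \in `[0, T] -> C1_on (Phi t @` Omega) (u t).
Proof.
move=> t tT.
have [[uc u0E] [_ _ uW] [ut [ux [q [wux dut [Cut _ Ch] eqn]]]] _] := u_sol.
have [M M0 uM] := u_bounds T_gt0 uc dut Cut uW.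
have D := DP_transport_data uc wux dut Cut Ch eqn M0
  (fun s x sT => (uM s sT).1 x) (fun s sT => (uM s sT).2).
have Phi0 x : Phi 0 x = x by case: (Phi_flow x).
have dPhi x s : s \in `[0, T] -> slope_cvg T (Phi ^~ x) s (u s (Phi s x)).
  by have [_] := Phi_flow x; apply.
apply: strict_slopes_C1_on => _ [y0 Oy0 <-].
apply: (strict_slopes_transport D T_gt0 Phi0 dPhi) => //.
by rewrite u0E; exact: C1_on_strict_slopes Omega_open u0_C1 Oy0.
Qed.
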